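(* If $f: [\omega]^2 \to \omega$ is 2-bounded, then there exists an infinite $f$-rainbow $X \subseteq \omega$ of non-PA Turing degree.
   Context: A coloring $f:[\omega]^2\to\omega$ is 2-bounded if $|f^{-1}(c)|\le 2$ for all $c$; an $f$-rainbow is a set $R$ such that $f$ is injective on $[R]^2$. A set is of PA degree if it computes a function $h:\omega\to 2$ with $h(e)\neq\varphi_e(e)$ whenever $\varphi_e(e)$ converges ($\varphi_e$ the $e$-th partial recursive function); otherwise it is of non-PA degree. No effectivity assumption is made on $f$. *)

(* Defs.v *)
From Stdlib Require Cantor.
From mathcomp Require Import all_boot finmap.
From mathcomp Require Import boolp classical_sets functions cardinality.

Set Implicit Arguments.
Unset Strict Implicit.
Unset Printing Implicit Defensive.

Local Open Scope fset_scope.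
Local Open Scope classical_set_scope.
Local Open Scope nat_scope.

(** [upair] is the type [omega]^2, and [upairs X] is [X]^2 as a subset of it. *)
Definition upair : Type := {s : {fset nat} | #|` s| == 2}.

Definition upairs (X : set nat) : set upair :=
  [set p : upair | forall x, x \in val p -> X x].

Definition two_bounded (f : upair -> nat) : Prop :=
  forall c : nat, (f @^-1` [set c] #<= `I_2)%card.

Definition rainbow (f : upair -> nat) (R : set nat) : Prop :=
  set_inj (upairs R) f.

(** Programs for the unary partial functions that are partial recursive in an
    oracle; several arguments are passed through Cantor's pairing function, and
    the identity is [Pair Fst Snd]. *)
Inductive code : Type :=
| Zero
| Succ
| Fst
| Snd
| Query
| Pair of code & code
| Comp of code & code
| Prec of code & code
| Mu of code.

Notation cpair x y := (Cantor.to_nat (x, y)).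

(** [eval X c x y] : the program [c] with oracle [X] halts on input [x] with
    output [y].  [Comp c d] is c after d; [Prec c d] is primitive recursion on
    the second component of the input; [Mu c] is unbounded minimisation, which
    diverges if [c] diverges before a zero is found. *)
Fixpoint eval (X : set nat) (c : code) (x y : nat) {struct c} : Prop :=
  match c with
  | Zero => y = 0
  | Succ => y = x.+1
  | Fst => y = (Cantor.of_nat x).1
  | Snd => y = (Cantor.of_nat x).2
  | Query => y = (x \in X)
  | Pair c d => exists u v, [/\ eval X c x u, eval X d x v & y = cpair u v]
  | Comp c d => exists2 u, eval X d x u & eval X c u y
  | Prec c d =>
      let a := (Cantor.of_nat x).1 in
      (fix rec (n z : nat) {struct n} : Prop :=
         match n with
         | 0 => eval X c a z
         | n'.+1 => exists2 u, rec n' u & eval X d (cpair a (cpair n' u)) z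
         end) (Cantor.of_nat x).2 y
  | Mu c =>
      eval X c (cpair x y) 0 /\
      forall i, i < y -> exists u, eval X c (cpair x i) u.+1
  end.

Lemma eval_functional X c x y z : eval X c x y -> eval X c x z -> y = z.
Proof.
elim: c x y z => [||||| c IHc d IHd | c IHc d IHd | c IHc d IHd | c IHc] x y z /=.
1-5: by move=> -> ->.
- move=> [u [v [cu dv ->]]] [u' [v' [cu' dv' ->]]].
  by rewrite (IHc _ _ _ cu cu') (IHd _ _ _ dv dv').
- move=> [u du cu] [v dv cv]; rewrite (IHd _ _ _ du dv) in cu.
  exact: IHc cu cv.
- elim: (Cantor.of_nat x).2 y z => [|n IHn] y z; first exact: IHc.
  move=> [u ru du] [v rv dv]; rewrite (IHn _ _ ru rv) in du.
  exact: IHd du dv.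
- move=> [cy yP] [cz zP]; case: (ltngtP y z) => // [/zP|/yP] [u cu].
  + by have := IHc _ _ _ cy cu.
  + by have := IHc _ _ _ cz cu.
Qed.

Fixpoint encode (c : code) : nat :=
  match c with
  | Zero => cpair 0 0
  | Succ => cpair 1 0
  | Fst => cpair 2 0
  | Snd => cpair 3 0
  | Query => cpair 4 0
  | Pair c d => cpair 5 (cpair (encode c) (encode d))
  | Comp c d => cpair 6 (cpair (encode c) (encode d))
  | Prec c d => cpair 7 (cpair (encode c) (encode d))
  | Mu c => cpair 8 (encode c)
  end.

Lemma encode_inj : injective encode.
Proof.
have cantor_inj a b a' b' : cpair a b = cpair a' b' -> a = a' /\ b = b'.
  by move=> /Cantor.to_nat_inj [-> ->].
elim=> [||||| c IHc d IHd | c IHc d IHd | c IHc d IHd | c IHc]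
  [||||| c' d' | c' d' | c' d' | c'] //;
  rewrite -/(encode _) => /cantor_inj [] // _.
1-3: by move=> /cantor_inj [/IHc -> /IHd ->].
by move=> /IHc ->.
Qed.

(** The graph of the e-th partial recursive function, computed with the empty
    oracle; an [e] that is not the number of a program indexes the nowhere
    defined function. *)
Definition phi (e x y : nat) : Prop :=
  exists2 c, encode c = e & eval set0 c x y.

Definition computes (X : set nat) (g : nat -> nat) : Prop :=
  exists c, forall x, eval X c x (g x).

Definition PA_degree (X : set nat) : Prop :=
  exists2 h : nat -> bool,
    computes X (fun e => nat_of_bool (h e)) &
    forall e y, phi e e y -> nat_of_bool (h e) <> y.

(* Main.v *)
(** A finite rainbow [F] with an infinite reservoir [Y] of non-PA degree is
    extended as in Mathias forcing, together with a family [P] of finite sets to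
    which all further stems must belong. The families allowed are [sparse]: the
    number of incompatible pairs among the one-point extensions of a set is at
    most linear. The rainbows of a 2-bounded coloring form a sparse family, and
    sparse families are stable under intersections and under limits along an
    ultrafilter, while they form a compact class. Hence "every sparse family
    contains an extension of [F] on which the functional [d] takes the value [b]
    at [x]" is enumerable in [Y]. If for each [x] this holds for some [b], then,
    [Y] being non-PA, it holds for some [x] with [b] the value of the diagonal
    function at [x]; the family applied is the limit of [P] along an ultrafilter
    of sets with infinite subsets of non-PA degree, so that the extension has a
    reservoir. Otherwise some [x] has two counterexamples, and intersecting [P]
    with them forces divergence at [x].

    The ultrafilter exists by Liu's theorem that one side of each partition of
    [Y] has an infinite subset of non-PA degree. It is proved by a similar
    forcing, where reservoirs range over the sets avoiding some r.e. set of
    finite sets, and the largeness of such a class means that it is not in a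
    fixed maximal collection whose ideal does not contain [Y]. *)

Require Import Defs.
From mathcomp Require Import all_boot finmap.
From mathcomp Require Import boolp classical_sets functions cardinality filter.
From mathcomp Require Import zify.

Set Implicit Arguments.
Unset Strict Implicit.
Unset Printing Implicit Defensive.

Local Open Scope classical_set_scope.
Local Open Scope nat_scope.

(** * Computable functions and finite sets *)

Definition pi1 z := (Cantor.of_nat z).1.
Definition pi2 z := (Cantor.of_nat z).2.

Arguments Cantor.to_nat : simpl never.
Arguments Cantor.of_nat : simpl never.

Lemma pi1_pair x y : pi1 (cpair x y) = x.
Proof. by rewrite /pi1 Cantor.cancel_of_to. Qed.

Lemma pi2_pair x y : pi2 (cpair x y) = y.
Proof. by rewrite /pi2 Cantor.cancel_of_to. Qed.

Definition cpairE := (pi1_pair, pi2_pair).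

Lemma pair_pi z : cpair (pi1 z) (pi2 z) = z.
Proof. by rewrite /pi1 /pi2 -surjective_pairing Cantor.cancel_to_of. Qed.

Lemma leq_addpair x y : y + x <= cpair x y.
Proof. by apply/leP/Cantor.to_nat_non_decreasing. Qed.

Lemma leq_pair2 x y : y <= cpair x y.
Proof. by have := leq_addpair x y; lia. Qed.

(** * Closure properties of computability with an oracle *)

Section Computable.
Variable X : set nat.
Local Notation comp := (computes X).

Lemma comp_ext f g : f =1 g -> comp f -> comp g.
Proof. by move=> fg [c cP]; exists c => x; rewrite -fg. Qed.

Lemma comp_succ f : comp f -> comp (fun z => (f z).+1).
Proof. by move=> [c cP]; exists (Comp Succ c) => x /=; exists (f x). Qed.

Lemma comp_const k : comp (fun=> k).
Proof. by elim: k => [|k IHk]; [exists Zero | apply: comp_succ]. Qed.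

Lemma comp_pi1 f : comp f -> comp (fun z => pi1 (f z)).
Proof. by move=> [c cP]; exists (Comp Fst c) => x /=; exists (f x). Qed.

Lemma comp_pi2 f : comp f -> comp (fun z => pi2 (f z)).
Proof. by move=> [c cP]; exists (Comp Snd c) => x /=; exists (f x). Qed.

Lemma comp_pair f g : comp f -> comp g -> comp (fun z => cpair (f z) (g z)).
Proof.
by move=> [c cP] [d dP]; exists (Pair c d) => x /=; exists (f x), (g x).
Qed.

Lemma comp_id : comp id.
Proof.
by apply: comp_ext pair_pi _; apply: comp_pair; [exists Fst | exists Snd].
Qed.

Lemma comp_comp g f : comp g -> comp f -> comp (fun z => g (f z)).
Proof. by move=> [c cP] [d dP]; exists (Comp c d) => x /=; exists (f x). Qed.

Lemma comp_query f : comp f -> comp (fun z => nat_of_bool (f z \in X)).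
Proof. by move=> [c cP]; exists (Comp Query c) => x /=; exists (f x). Qed.

(** The arithmetic below reduces to this form of primitive recursion. [Prec] keeps its parameter in
    the first component of the input, so the number of iterations is first made a separate
    argument. *)
Lemma comp_iteri (k b : nat -> nat) (h : nat -> nat -> nat -> nat) :
    comp k -> comp (fun w => h (pi1 w) (pi1 (pi2 w)) (pi2 (pi2 w))) -> comp b ->
  comp (fun z => iteri (k z) (h z) (b z)).
Proof.
move=> [ck kP] [ch hP] [cb bP].
suff [c cP] : comp (fun w => iteri (pi2 w) (h (pi1 w)) (b (pi1 w))).
  have [c' c'P] := comp_pair comp_id (ex_intro _ ck kP).
  by exists (Comp c c') => z /=; exists (cpair z (k z)) => //;
    have := cP (cpair z (k z)); rewrite !cpairE.
exists (Prec cb ch) => w /=; rewrite -/(pi1 w) -/(pi2 w).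
elim: (pi2 w) => [|n IHn]; first exact: bP.
exists (iteri n (h (pi1 w)) (b (pi1 w))) => //=.
by have := hP (cpair (pi1 w) (cpair n (iteri n (h (pi1 w)) (b (pi1 w))))); rewrite !cpairE.
Qed.

Lemma comp_pred f : comp f -> comp (fun z => (f z).-1).
Proof.
move=> cf; apply: (@comp_ext (fun z => iteri (f z) (fun n _ => n) 0)).
  by move=> z; case: (f z).
apply: comp_iteri => //; last exact: comp_const.
by apply: comp_pi1; apply: comp_pi2; apply: comp_id.
Qed.

Lemma comp_add f g : comp f -> comp g -> comp (fun z => f z + g z).
Proof.
move=> cf cg; apply: (@comp_ext (fun z => iteri (g z) (fun _ u => u.+1) (f z))).
  by move=> z; elim: (g z) => [|n /= ->]; rewrite ?addn0 ?addnS.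
by apply: comp_iteri => //; apply: comp_succ; exact: comp_pi2 (comp_pi2 comp_id).
Qed.

Lemma comp_sub f g : comp f -> comp g -> comp (fun z => f z - g z).
Proof.
move=> cf cg; apply: (@comp_ext (fun z => iteri (g z) (fun _ u => u.-1) (f z))).
  by move=> z; elim: (g z) => [|n /= ->]; rewrite ?subn0 ?subnS.
by apply: comp_iteri => //; apply: comp_pred; exact: comp_pi2 (comp_pi2 comp_id).
Qed.

Lemma comp_sum (F : nat -> nat -> nat) b :
    comp (fun w => F (pi1 w) (pi2 w)) -> comp b ->
  comp (fun z => \sum_(i < b z) F z i).
Proof.
move=> cF cb; apply: (@comp_ext (fun z => iteri (b z) (fun i u => u + F z i) 0)).
  move=> z; elim: (b z) => [|n IHn] /=; first by rewrite big_ord0.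
  by rewrite big_ord_recr IHn.
apply: comp_iteri => //; last exact: comp_const.
apply: comp_add; first by exact: comp_pi2 (comp_pi2 comp_id).
have c1 : comp (fun w => cpair (pi1 w) (pi1 (pi2 w))).
  by apply: comp_pair; [| apply: comp_pi1]; [apply: comp_pi1 | apply: comp_pi2]; apply: comp_id.
by apply: comp_ext (comp_comp cF c1) => w; rewrite !cpairE.
Qed.

Lemma comp_mul f g : comp f -> comp g -> comp (fun z => f z * g z).
Proof.
move=> cf cg; apply: (@comp_ext (fun z => \sum_(i < f z) g z)).
  by move=> z; rewrite sum_nat_const card_ord.
by apply: (@comp_sum (fun z _ => g z)) => //; exact: (comp_comp cg (comp_pi1 comp_id)).
Qed.

Lemma comp_exp2 f : comp f -> comp (fun z => 2 ^ f z).
Proof.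
move=> cf; apply: (@comp_ext (fun z => iteri (f z) (fun _ u => u + u) 1)).
  by move=> z; elim: (f z) => // n /= ->; rewrite expnS mul2n addnn.
apply: comp_iteri => //; last exact: comp_const.
by apply: comp_add; exact: comp_pi2 (comp_pi2 comp_id).
Qed.

Definition dec (P : nat -> bool) := comp (fun z => nat_of_bool (P z)).

Lemma dec_not P : dec P -> dec (fun z => ~~ P z).
Proof.
move=> cP; apply: (@comp_ext (fun z => 1 - P z)); first by move=> z; case: (P z).
by apply: comp_sub => //; apply: comp_const.
Qed.

Lemma dec_and P Q : dec P -> dec Q -> dec (fun z => P z && Q z).
Proof.
move=> cP cQ; apply: (@comp_ext (fun z => P z * Q z)); last exact: comp_mul.
by move=> z; rewrite mulnb.
Qed.

Lemma dec_or P Q : dec P -> dec Q -> dec (fun z => P z || Q z).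
Proof.
move=> cP cQ; apply: (@comp_ext (fun z => ~~ (~~ P z && ~~ Q z))).
  by move=> z; rewrite negb_and !negbK.
by apply/dec_not/dec_and; apply: dec_not.
Qed.

Lemma dec_implb P Q : dec P -> dec Q -> dec (fun z => P z ==> Q z).
Proof.
move=> cP cQ; apply: (@comp_ext (fun z => ~~ P z || Q z)).
  by move=> z; rewrite implybE.
by apply: dec_or => //; apply: dec_not.
Qed.

Lemma dec_leq f g : comp f -> comp g -> dec (fun z => f z <= g z).
Proof.
move=> cf cg; apply: (@comp_ext (fun z => 1 - (f z - g z))).
  by move=> z; rewrite -subn_eq0; case: (f z - g z).
by apply: comp_sub; [exact: comp_const | exact: comp_sub].
Qed.

Lemma dec_eq f g : comp f -> comp g -> dec (fun z => f z == g z).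
Proof.
move=> cf cg; apply: (@comp_ext (fun z => (f z <= g z) && (g z <= f z))).
  by move=> z; rewrite -eqn_leq.
by apply: dec_and; apply: dec_leq.
Qed.

Lemma comp_if P f g :
  dec P -> comp f -> comp g -> comp (fun z => if P z then f z else g z).
Proof.
move=> cP cf cg; apply: (@comp_ext (fun z => P z * f z + ~~ P z * g z)).
  by move=> z; case: (P z); rewrite ?mul1n ?mul0n ?addn0.
by apply: comp_add; apply: comp_mul => //; apply: dec_not.
Qed.

Lemma dec_all (P : nat -> nat -> bool) b :
    dec (fun w => P (pi1 w) (pi2 w)) -> comp b ->
  dec (fun z => all (P z) (iota 0 (b z))).
Proof.
move=> cP cb; apply: (@comp_ext (fun z => \sum_(i < b z) ~~ P z i <= 0)).
  move=> z; rewrite leqn0 sum_nat_eq0; congr nat_of_bool.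
  apply/forallP/allP => [H i|H i].
    by rewrite mem_iota => /andP[_ ilt]; have := H (Ordinal ilt); case: (P z i).
  by have := H (i : nat); rewrite mem_iota ltn_ord => -> //; apply/implyP.
apply: dec_leq; last exact: comp_const.
apply: (@comp_sum (fun z i => nat_of_bool (~~ P z i))) => //.
exact: dec_not cP.
Qed.

Lemma dec_has (P : nat -> nat -> bool) b :
    dec (fun w => P (pi1 w) (pi2 w)) -> comp b ->
  dec (fun z => has (P z) (iota 0 (b z))).
Proof.
move=> cP cb; apply: (@comp_ext (fun z => ~~ all (fun i => ~~ P z i) (iota 0 (b z)))).
  by move=> z; rewrite -has_predC; congr nat_of_bool; apply: eq_has => i /=; rewrite negbK.
apply: dec_not; apply: (@dec_all (fun z i => ~~ P z i)) => //.
exact: dec_not cP.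
Qed.

(** Since [Mu] looks for the value 0, it is run on the negation of [P], whose value 1 below the
    least witness is the successor that [Mu] requires. *)
Lemma comp_mu (P : nat -> nat -> bool) (exP : forall z, exists s, P z s) :
  dec (fun w => P (pi1 w) (pi2 w)) -> comp (fun z => ex_minn (exP z)).
Proof.
move=> /dec_not [c cP]; exists (Mu c) => z /=; case: ex_minnP => m Pm mP; split.
  by have := cP (cpair z m); rewrite !cpairE Pm.
move=> i im; exists 0; have := cP (cpair z i); rewrite !cpairE.
by have -> : P z i = false by apply/negP => /mP; rewrite leqNgt im.
Qed.

Lemma dec_odd f : comp f -> dec (fun z => odd (f z)).
Proof.
move=> cf; apply: (@comp_ext (fun z => iteri (f z) (fun _ u => 1 - u) 0)).
  by move=> z; elim: (f z) => // n /= ->; case: (odd n).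
apply: comp_iteri => //; last exact: comp_const.
by apply: comp_sub; [exact: comp_const | exact: comp_pi2 (comp_pi2 comp_id)].
Qed.

Lemma comp_half f : comp f -> comp (fun z => (f z)./2).
Proof.
move=> cf; apply: (@comp_ext (fun z => \sum_(i < f z) odd i)).
  move=> z; elim: (f z) => [|n IHn]; first by rewrite big_ord0.
  by rewrite big_ord_recr IHn /= uphalf_half addnC.
by apply: (@comp_sum (fun _ i => nat_of_bool (odd i))) => //; apply: dec_odd;
  exact: (comp_pi2 comp_id).
Qed.

End Computable.

(** A natural number [w] stands for the finite set of the [i] with [bit w i]. *)
Definition bit (w i : nat) : bool := odd (iter i half w).

Lemma bit0 w : bit w 0 = odd w. Proof. by []. Qed.

Lemma bitS w i : bit w i.+1 = bit w./2 i.
Proof. by rewrite /bit iterSr. Qed.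

Lemma dec_bit X f g :
  computes X f -> computes X g -> dec X (fun z => bit (f z) (g z)).
Proof.
move=> cf cg; rewrite /bit /dec.
apply: (@comp_ext X (fun z => odd (iteri (g z) (fun _ => half) (f z)))) => //.
apply: dec_odd; apply: comp_iteri => //.
by apply: comp_half; exact: comp_pi2 (comp_pi2 (comp_id X)).
Qed.

Fixpoint code_of (n : nat) (P : nat -> bool) : nat :=
  if n is n'.+1 then P 0 + (code_of n' (fun i => P i.+1)).*2 else 0.

Lemma half_code_of n P : (code_of n.+1 P)./2 = code_of n (fun i => P i.+1).
Proof. by rewrite /= halfD odd_double andbF doubleK; case: (P 0). Qed.

Lemma bit_code_of n P i : bit (code_of n P) i = (i < n) && P i.
Proof.
elim: n P i => [|n IHn] P i; last case: i => [|i]; rewrite ?bitS.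
- by rewrite /= /bit; have -> : iter i half 0 = 0 by elim: i => //= i ->.
- by rewrite bit0 /= oddD odd_double addbF; case: (P 0).
- by rewrite half_code_of IHn ltnS.
Qed.

Lemma code_of_lt n P : code_of n P < 2 ^ n.
Proof.
elim: n P => [|n IHn] P //=; rewrite expnS mul2n.
by have := IHn (fun i => P i.+1); case: (P 0) => /=; lia.
Qed.

Lemma bit_0 i : bit 0 i = false.
Proof. by have := bit_code_of 0 xpred0 i. Qed.

Lemma bit_ltn w i : bit w i -> i < w.
Proof.
elim: i w => [|i IHi] w; first by rewrite bit0; case: w.
by rewrite bitS => /IHi; case: w => //= w; lia.
Qed.

Lemma bit_inj w v : bit w =1 bit v -> w = v.
Proof.
move: w; elim/ltn_ind: v => v IHv w wv.
have wv2 : w./2 = v./2.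
  have [v0|v_gt0] := posnP v.
    suff -> : w = v by [].
    apply/eqP; rewrite v0 -leqn0 leqNgt; apply/negP => w_gt0.
    have : forall u, 0 < u -> exists i, bit u i.
      elim/ltn_ind => u IHu u0; case: (boolP (odd u)) => [|oddN]; first by exists 0.
      have /IHu [|i iP] : u./2 < u by lia.
        by lia.
      by exists i.+1; rewrite bitS.
    by move=> /(_ w w_gt0) [i]; rewrite wv v0 bit_0.
  by apply: IHv => [|i]; [lia | rewrite -!bitS wv].
by rewrite -[w]odd_double_half -[v]odd_double_half wv2; have := wv 0; rewrite !bit0 => ->.
Qed.

Lemma bit_pow2 n i : bit (2 ^ n) i = (i == n).
Proof.
suff -> : 2 ^ n = code_of n.+1 (pred1 n).
  by rewrite bit_code_of ltnS /= andb_idl // => /eqP ->.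
elim: n => // n IHn; rewrite expnS IHn [RHS]/= mul2n.
by congr (_.*2).
Qed.

Definition adjoin (w i : nat) : nat := if bit w i then w else w + 2 ^ i.

Lemma bit_adjoin w i j : bit (adjoin w i) j = bit w j || (j == i).
Proof.
rewrite /adjoin; case: ifPn => [wi|]; first by case: eqP => [->|]; rewrite ?wi ?orbF.
elim: i w j => [|i IHi] w j wi.
  case: j => [|j]; first by move: wi; rewrite !bit0 oddD /= orbT; case: (odd w).
  rewrite !bitS orbF; congr bit.
  by move: wi; rewrite bit0 expn0; lia.
have e : (w + 2 ^ i.+1)./2 = w./2 + 2 ^ i by rewrite expnS; lia.
case: j => [|j]; first by rewrite !bit0 oddD expnS oddM /= orbF; case: (odd w).
by rewrite !bitS e IHi // -bitS.
Qed.

Lemma comp_adjoin X f g : computes X f -> computes X g ->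
  computes X (fun z => adjoin (f z) (g z)).
Proof.
move=> cf cg; rewrite /adjoin; apply: comp_if => //; first exact: dec_bit.
by apply: comp_add => //; apply: comp_exp2.
Qed.

Definition card_bit (w : nat) : nat := \sum_(i < w) bit w i.

Lemma comp_card X f : computes X f -> computes X (fun z => card_bit (f z)).
Proof.
move=> cf; apply: (@comp_sum X (fun z i => nat_of_bool (bit (f z) i))) => //.
apply: dec_bit; last by exact: (comp_pi2 (comp_id X)).
by exact: (comp_comp cf (comp_pi1 (comp_id X))).
Qed.

(** * Recursively enumerable predicates and compactness *)

Definition dec2 (X : set nat) (D : nat -> nat -> bool) :=
  dec X (fun w => D (pi1 w) (pi2 w)).

Lemma dec_app X P f : dec X P -> computes X f -> dec X (fun z => P (f z)).
Proof. exact: comp_comp. Qed.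

Lemma dec_app2 X D f g :
  dec2 X D -> computes X f -> computes X g -> dec X (fun z => D (f z) (g z)).
Proof.
move=> cD cf cg; have := dec_app cD (comp_pair cf cg).
by apply: comp_ext => z; rewrite !cpairE.
Qed.

Lemma dec_const X b : dec X (fun=> b). Proof. exact: comp_const. Qed.

Lemma dec_query X f : computes X f -> dec X (fun z => f z \in X).
Proof. exact: comp_query. Qed.

Ltac comp_step :=
  cbv beta;
  match goal with
  | |- dec2 _ _ => unfold dec2
  | |- computes ?X (fun z => nat_of_bool (@?P z)) => change (dec X P)
  | H : ?G |- ?G => exact H
  | H : dec2 ?X ?D |- dec ?X (fun z => ?D _ _) => apply: (dec_app2 H)
  | H : dec ?X ?P |- dec ?X (fun z => ?P _) => apply: (dec_app H)
  | H : computes ?X ?f |- computes ?X (fun z => ?f _) => apply: (comp_comp H)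
  | |- computes ?X (fun z => z) => exact (comp_id X)
  | |- computes ?X (fun=> ?k) => exact (comp_const X k)
  | |- dec ?X (fun=> ?k) => exact (dec_const X k)
  | |- computes _ (fun z => pi1 _) => apply: comp_pi1
  | |- computes _ (fun z => pi2 _) => apply: comp_pi2
  | |- computes _ pi1 => apply: comp_pi1
  | |- computes _ pi2 => apply: comp_pi2
  | |- computes _ (fun z => Cantor.to_nat _) => apply: comp_pair
  | |- computes _ (fun z => S _) => apply: comp_succ
  | |- computes _ (fun z => predn _) => apply: comp_pred
  | |- computes _ (fun z => addn _ _) => apply: comp_add
  | |- computes _ (fun z => muln _ _) => apply: comp_mul
  | |- computes _ (fun z => subn _ _) => apply: comp_sub
  | |- computes _ (fun z => expn 2 _) => apply: comp_exp2
  | |- computes _ (fun z => adjoin _ _) => apply: comp_adjoin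
  | |- computes _ (fun z => card_bit _) => apply: comp_card
  | |- dec _ (fun z => ~~ _) => apply: dec_not
  | |- dec _ (fun z => _ && _) => apply: dec_and
  | |- dec _ (fun z => _ || _) => apply: dec_or
  | |- dec _ (fun z => _ ==> _) => apply: dec_implb
  | |- dec _ (fun z => leq _ _) => apply: dec_leq
  | |- dec _ (fun z => _ == _) => apply: dec_eq
  | |- dec _ (fun z => odd _) => apply: dec_odd
  | |- dec _ (fun z => bit _ _) => apply: dec_bit
  | |- dec ?X (fun z => all (@?P z) (iota 0 (@?b z))) => apply: (@dec_all X P b)
  | |- dec ?X (fun z => has (@?P z) (iota 0 (@?b z))) => apply: (@dec_has X P b)
  | |- dec ?X (fun z => in_mem (@?f z) (mem ?X)) => apply: (@dec_query X f)
  end.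
Ltac comp_auto := repeat comp_step.

Lemma allnP (P : nat -> bool) n :
  reflect (forall i, i < n -> P i) (all P (iota 0 n)).
Proof.
by apply: (iffP allP) => H i; have := H i; rewrite mem_iota.
Qed.

Lemma hasnP (P : nat -> bool) n :
  reflect (exists2 i, i < n & P i) (has P (iota 0 n)).
Proof.
by apply: (iffP hasP) => -[i]; rewrite ?mem_iota => ilt Pi; exists i; rewrite ?mem_iota.
Qed.

Definition sub_bit a b := all (fun i => bit a i ==> bit b i) (iota 0 a).
Definition disj_bit a b := all (fun i => bit a i ==> ~~ bit b i) (iota 0 a).

Lemma sub_bitP a b : reflect (forall i, bit a i -> bit b i) (sub_bit a b).
Proof.
apply: (iffP (allnP _ _)) => [H i ai|H i _]; last exact/implyP/H.
by have := H i (bit_ltn ai); rewrite ai.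
Qed.

Lemma disj_bitP a b : reflect (forall i, bit a i -> ~~ bit b i) (disj_bit a b).
Proof.
apply: (iffP (allnP _ _)) => [H i ai|H i _]; last exact/implyP/H.
by have := H i (bit_ltn ai); rewrite ai.
Qed.

(** [sigma X A] says that [A] is r.e. in [X]. *)
Definition sigma (X : set nat) (A : nat -> Prop) :=
  exists2 D : nat -> nat -> bool, dec2 X D & forall z, A z <-> exists s, D z s.

Section Sigma.
Variable X : set nat.
Implicit Types A B : nat -> Prop.

Lemma sigma_ext A B : (forall z, A z <-> B z) -> sigma X A -> sigma X B.
Proof. by move=> AB [D cD DA]; exists D => // z; rewrite -AB. Qed.

Lemma sigma_dec P : dec X P -> sigma X (fun z => P z).
Proof.
move=> cP; exists (fun z _ => P z); last by move=> z; split=> [|[]] //; exists 0.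
by comp_auto.
Qed.

Lemma sigma_and A B : sigma X A -> sigma X B -> sigma X (fun z => A z /\ B z).
Proof.
move=> [D cD DA] [E cE EB]; exists (fun z s => D z (pi1 s) && E z (pi2 s)).
  by comp_auto.
move=> z; rewrite DA EB; split=> [[[s Ds] [t Et]]|[s /andP[Ds Es]]].
  by exists (cpair s t); rewrite !cpairE Ds.
by split; [exists (pi1 s) | exists (pi2 s)].
Qed.

Lemma sigma_or A B : sigma X A -> sigma X B -> sigma X (fun z => A z \/ B z).
Proof.
move=> [D cD DA] [E cE EB]; exists (fun z s => D z s || E z s).
  by comp_auto.
move=> z; rewrite DA EB; split=> [[[s Ds]|[s Es]]|[s /orP[Ds|Es]]].
- by exists s; rewrite Ds.
- by exists s; rewrite Es orbT.
- by left; exists s.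
- by right; exists s.
Qed.

Lemma sigma_app A f : sigma X A -> computes X f -> sigma X (fun z => A (f z)).
Proof.
move=> [D cD DA] cf; exists (fun z s => D (f z) s) => [|z]; last exact: DA.
by comp_auto.
Qed.

Lemma sigma_ex (A : nat -> nat -> Prop) :
  sigma X (fun w => A (pi1 w) (pi2 w)) -> sigma X (fun z => exists n, A z n).
Proof.
move=> [D cD DA]; exists (fun z s => D (cpair z (pi1 s)) (pi2 s)).
  by comp_auto.
move=> z; split=> [[n Azn]|[s Ds]].
  have /DA [s Ds] : A (pi1 (cpair z n)) (pi2 (cpair z n)) by rewrite !cpairE.
  by exists (cpair n s); rewrite !cpairE.
by exists (pi1 s); have := (DA (cpair z (pi1 s))).2; rewrite !cpairE; apply; exists (pi2 s).
Qed.

Lemma sigma_finite_or (A : nat -> nat -> Prop) n :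
    (forall i, i < n -> sigma X (A i)) ->
  sigma X (fun z => exists2 i, i < n & A i z).
Proof.
elim: n => [|n IHn] AP.
  by apply: sigma_ext (sigma_dec (dec_const X false)) => z; split=> // -[].
have := sigma_or (IHn (fun i ilt => AP i (ltnW ilt))) (AP n (ltnSn n)).
apply: sigma_ext => z; split=> [[[i ilt Ai]|An]|[i]].
- by exists i; first exact: ltnW.
- by exists n.
- by rewrite ltnS leq_eqVlt => /orP[/eqP ->|ilt] Ai; [right | left; exists i].
Qed.

End Sigma.

(** The sets whose complement in [Y] is not in [N] form a proper filter. An ultrafilter above it has
    no member [A] outside [N], since the complement of such an [A] would belong to the filter. *)
Lemma large_ultrafilter (N : set (set nat)) (Y : set nat) :
    (forall A B, A `<=` B -> N A -> N B) ->
    (forall A B, N (A `|` B) -> N A \/ N B) ->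
    ~ N set0 -> N Y ->
  exists U : set (set nat), [/\ UltraFilter U, U Y & U `<=` N].
Proof.
move=> Nsub NU N0 NY.
pose F : set (set nat) := [set A | ~ N (Y `\` A)].
have FF : ProperFilter F.
  apply: Build_ProperFilter; first by rewrite /F /= setD0.
  split; first by rewrite /F /= setDT.
    move=> A B FA FB; rewrite /F /= setDIr => /NU [].
      exact: FA.
    exact: FB.
  move=> A B AB FA; apply: contra_not FA; apply: Nsub.
  by move=> x [Yx nBx]; split=> // /AB.
have [U [UU FU]] := ultraFilterLemma FF.
exists U; split=> [//||A UA]; first by apply: FU; rewrite /F /= setDv.
apply: contrapT => NA.
have /FU UC : F (~` A) by rewrite /F /= setDE setCK; apply: contra_not NA; apply: Nsub.
by have /filter_ex [? []] : U (A `&` ~` A) by exact: filterI.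
Qed.

Lemma infinite_setU (A B : set nat) :
  infinite_set (A `|` B) -> infinite_set A \/ infinite_set B.
Proof.
move=> AB; apply: contrapT => /not_orP [/contrapT fA /contrapT fB].
by apply: AB; rewrite finite_setU.
Qed.

Lemma filter_finite (U : set (set nat)) (P : nat -> set nat) n :
    UltraFilter U -> (forall i, i < n -> U (P i)) ->
  U [set s | forall i, i < n -> P i s].
Proof.
move=> UU; elim: n => [|n IHn] UP; first exact: filterS filterT.
apply: filterS (filterI (IHn (fun i ilt => UP i (ltnW ilt))) (UP n (ltnSn n))).
move=> s [H Pn] i; rewrite ltnS leq_eqVlt => /orP[/eqP -> //|]; exact: H.
Qed.

Lemma infinite_ge (A : set nat) (m : nat) : infinite_set A -> exists2 n, m <= n & A n.
Proof.
move=> Ai; apply: contrapT => H; apply: Ai.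
apply: (@sub_finite_set _ _ `I_m); last exact: finite_II.
by move=> n An /=; rewrite ltnNge; apply/negP => mn; apply: H; exists n.
Qed.

(** Compactness of Cantor space: the quantifier over all sets [Q] is harmless. *)
Lemma sigma_compact X (R : nat -> nat -> nat -> Prop) :
    sigma X (fun w => R (pi1 w) (pi1 (pi2 w)) (pi2 (pi2 w))) ->
  sigma X (fun z => forall Q : set nat, exists a b,
    [/\ forall i, bit a i -> Q i, forall i, bit b i -> ~ Q i & R z a b]).
Proof.
move=> [D cD DR].
(* A stage [S] succeeds if every pattern [t] below [2 ^ S] has a witness [(a, b, s)] below [S]; this
   is a bounded, hence decidable, condition on [S]. *)
pose E z S t := has (fun a => has (fun b => has (fun s =>
  [&& sub_bit a t, disj_bit b t & D (cpair z (cpair a b)) s])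
  (iota 0 S)) (iota 0 S)) (iota 0 S).
have DRE z a b : R z a b <-> exists s, D (cpair z (cpair a b)) s.
  by have := DR (cpair z (cpair a b)); rewrite !cpairE.
exists (fun z S => all (fun t => E z S t) (iota 0 (2 ^ S))).
  by rewrite /E /sub_bit /disj_bit; comp_auto.
move=> z; split=> [H|[S /allnP allE] Q]; last first.
  have /hasnP [a aS /hasnP [b bS /hasnP [s sS]]] := allE _ (code_of_lt S (fun i => i \in Q)).
  move=> /and3P[/sub_bitP at_ /disj_bitP bt Ds]; exists a, b; split.
  - by move=> i /at_; rewrite bit_code_of => /andP[_ /set_mem].
  - move=> i bi /mem_set Qi; have /negP := bt _ bi; apply.
    by rewrite bit_code_of (ltn_trans (bit_ltn bi) bS).
  - by apply/DRE; exists s.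
apply: contrapT => noS.
have {noS} /choice [t tP] : forall S, exists t, t < 2 ^ S /\ ~~ E z S t.
  move=> S; apply: contrapT => not; apply: noS; exists S; apply/allnP => t tS.
  by apply: contrapT => /negP nE; apply: not; exists t.
have [||||U [UU _ Uinf]] := @large_ultrafilter [set A | infinite_set A] setT.
- by move=> A B AB; apply: contra_not; apply: sub_finite_set.
- exact: infinite_setU.
- by apply; exact: finite_set0.
- exact: infinite_nat.
(* The escaping patterns [t S] converge along the nonprincipal ultrafilter [U] to a set [Q]. A
   finite witness for [Q] is one for [t S] for [U]-many [S], hence for some large [S]. *)
have [a [b [aQ bQ /DRE [s Ds]]]] := H [set i | U [set S | bit (t S) i]].
have Ua : U [set S | forall i, i < a -> bit a i -> bit (t S) i].
  apply: (@filter_finite _ (fun i => [set S | bit a i -> bit (t S) i])) => i _.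
  case: (boolP (bit a i)) => [/aQ Ui|_].
    by apply: (filterS _ Ui) => S /=.
  by apply: filterS filterT => S _ /=.
have Ub : U [set S | forall i, i < b -> bit b i -> ~~ bit (t S) i].
  apply: (@filter_finite _ (fun i => [set S | bit b i -> ~~ bit (t S) i])) => i _.
  case: (boolP (bit b i)) => [/bQ nQ|_]; last by apply: filterS filterT => S _ /=.
  have [//|] := in_ultra_setVsetC [set S | bit (t S) i] UU.
  by apply: filterS => S /= /negP nb _.
have [S Sge [aS bS]] := infinite_ge (a + b + s).+1 (Uinf _ (filterI Ua Ub)).
have [_ /negP] := tP S; apply; rewrite /E.
apply/hasnP; exists a; first by lia.
apply/hasnP; exists b; first by lia.
apply/hasnP; exists s; first by lia.
rewrite Ds andbT; apply/andP; split; [apply/sub_bitP|apply/disj_bitP] => i ib.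
  exact: aS (bit_ltn ib) ib.
exact: bS (bit_ltn ib) ib.
Qed.

(** * Finite certificates of computations *)

(** Bounded sums being computable, this form makes [cup] computable. *)
Lemma code_of_sum n P : code_of n P = \sum_(i < n) P i * 2 ^ i.
Proof.
elim: n P => [|n IHn] P; first by rewrite big_ord0.
rewrite big_ord_recl /= IHn muln1 -mul2n big_distrr /=; congr (_ + _).
by apply: eq_bigr => i _; rewrite /= /bump /= add1n expnS mulnCA.
Qed.

Definition cup a b := code_of (a + b) (fun i => bit a i || bit b i).

Lemma bit_cup a b i : bit (cup a b) i = bit a i || bit b i.
Proof.
rewrite bit_code_of; apply: andb_idl => /orP[] /bit_ltn; lia.
Qed.

Lemma comp_cup X f g : computes X f -> computes X g ->
  computes X (fun z => cup (f z) (g z)).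
Proof.
move=> cf cg; rewrite /cup.
apply: (@comp_ext X (fun z => \sum_(i < f z + g z) (bit (f z) i || bit (g z) i) * 2 ^ i)).
  by move=> z; rewrite code_of_sum.
apply: (@comp_sum X (fun z i => (bit (f z) i || bit (g z) i) * 2 ^ i)); comp_auto.
Qed.

(** [T e x y] means that the program number [e] is known to map [x] to [y]; the
    oracle [O] may only be queried below [l]. *)
Definition step (O : nat -> bool) (l : nat) (T : nat -> nat -> nat -> Prop)
    (e x y : nat) : Prop :=
  let e1 := pi1 (pi2 e) in let e2 := pi2 (pi2 e) in
  let a := pi1 x in let n := pi2 x in
  [\/ e = cpair 0 0 /\ y = 0,
      e = cpair 1 0 /\ y = x.+1,
      e = cpair 2 0 /\ y = pi1 x |
      e = cpair 3 0 /\ y = pi2 x] \/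
  [\/ [/\ e = cpair 4 0, x < l & y = O x],
      pi1 e = 5 /\ (exists u v, [/\ T e1 x u, T e2 x v & y = cpair u v]),
      pi1 e = 6 /\ (exists2 u, T e2 x u & T e1 u y) |
      pi1 e = 8 /\ (T (pi2 e) (cpair x y) 0 /\
        forall i, i < y -> exists u, T (pi2 e) (cpair x i) u.+1)] \/
  pi1 e = 7 /\
    ((n = 0 /\ T e1 a y) \/
     0 < n /\ (exists2 u, T e (cpair a n.-1) u &
                          T e2 (cpair a (cpair n.-1 u)) y)).

Definition entry L e x y := bit L (cpair e (cpair x y)).

(** A closed set of triples needs no ordering of its elements: [step] descends in
    the program, or in the recursion argument. *)
Definition cert O l L :=
  forall e x y, entry L e x y -> step O l (entry L) e x y.

Lemma step_mono O l l' (T T' : nat -> nat -> nat -> Prop) e x y :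
    l <= l' -> (forall e x y, T e x y -> T' e x y) ->
  step O l T e x y -> step O l' T' e x y.
Proof.
move=> ll' TT' [s|[s|[e7 s]]]; [by left|right; left|right; right; split=> //].
  case: s => [[? xl ?]|[? [u [v [? ? ?]]]]|[? [u ? ?]]|[? [? H]]].
  - by apply: Or41; split=> //; apply: leq_trans ll'.
  - by apply: Or42; split=> //; exists u, v; split=> //; exact: TT'.
  - by apply: Or43; split=> //; exists u; exact: TT'.
  - by apply: Or44; do 2?split=> //; first exact: TT'; move=> i /H [u ?]; exists u; exact: TT'.
by case: s => [[? ?]|[? [u ? ?]]]; [left|right]; split=> //; [exact: TT'|exists u; exact: TT'].
Qed.

(** Induction on the program: the tag of [encode c] rules out all clauses of [step] but one, and for
    [Prec] an inner induction follows the recursion argument. Queries stay below [l], so agreement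
    of the oracles there is enough. *)
Lemma cert_sound O l L (X : set nat) c x y :
    cert O l L -> (forall i, i < l -> (i \in X) = O i) ->
  entry L (encode c) x y -> eval X c x y.
Proof.
move=> Lc XO; elim: c x y => [||||| c IHc d IHd | c IHc d IHd | c IHc d IHd | c IHc] x y.
1-5: move=> /Lc; rewrite /step /= ?cpairE => -[[]|[[]|]] [];
  try by [move=> /Cantor.to_nat_inj []|].
- by move=> _ xl ->; rewrite XO.
- move=> /Lc; rewrite /step /= !cpairE => -[[]|[[]|]] []; try by [move=>
  /Cantor.to_nat_inj []|].
  by move=> _ [u [v [cu dv ->]]]; exists u, v; split; [exact: IHc|exact: IHd|].
- move=> /Lc; rewrite /step /= !cpairE => -[[]|[[]|]] []; try by [move=>
  /Cantor.to_nat_inj []|].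
  by move=> _ [u du cu]; exists u; [exact: IHd|exact: IHc].
- rewrite /= -/(pi1 x) -/(pi2 x) -[x in entry _ _ x _]pair_pi.
  elim: (pi2 x) y => [|n IHn] y /Lc;
    rewrite /step /= !cpairE => -[[]|[[]|]] []; try by [move=> /Cantor.to_nat_inj []|].
    by move=> _ [[_ /IHc]|[]].
  by move=> _ [[]|[_ [u /IHn ru /IHd du]]] //; exists u.
- move=> /Lc; rewrite /step /= !cpairE => -[[]|[[]|]] []; try by [move=>
  /Cantor.to_nat_inj []|].
  move=> _ [c0 H]; split; first exact: IHc.
  by move=> i /H [u cu]; exists u; exact: IHc.
Qed.

Lemma cert_cup O l l' L L' :
  cert O l L -> cert O l' L' -> cert O (maxn l l') (cup L L').
Proof.
move=> Lc Lc' e x y; rewrite /entry bit_cup => /orP[/Lc|/Lc'];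
  by apply: step_mono => [|? ? ?]; rewrite ?leq_maxl ?leq_maxr // /entry bit_cup => ->;
    rewrite ?orbT.
Qed.

Lemma cert_adjoin O l L e x y :
    cert O l L -> step O l (entry L) e x y ->
  cert O l (adjoin L (cpair e (cpair x y))) /\
  entry (adjoin L (cpair e (cpair x y))) e x y.
Proof.
move=> Lc s; split; last by rewrite /entry bit_adjoin eqxx orbT.
have LL a b c : entry L a b c -> entry (adjoin L (cpair e (cpair x y))) a b c.
  by rewrite /entry bit_adjoin => ->.
move=> a b c; rewrite /entry bit_adjoin => /orP[/Lc|/eqP]; first exact: step_mono.
by move=> /Cantor.to_nat_inj [-> /Cantor.to_nat_inj [-> ->]]; exact: step_mono s.
Qed.

Definition certified O c x y :=
  exists l L, cert O l L /\ entry L (encode c) x y.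

Lemma certified_step O l L c x y :
  cert O l L -> step O l (entry L) (encode c) x y -> certified O c x y.
Proof. by move=> Lc /(cert_adjoin Lc) [? ?]; exists l; eexists; split; eauto. Qed.

Lemma cert0 O l : cert O l 0.
Proof. by move=> e x y; rewrite /entry bit_0. Qed.

(** The certificates of the subcomputations are united by [cert_cup], and the last step is
    adjoined. *)
Lemma cert_complete (X : set nat) c x y :
  eval X c x y -> certified (fun i => i \in X) c x y.
Proof.
elim: c x y => [||||| c IHc d IHd | c IHc d IHd | c IHc d IHd | c IHc] x y /=.
- by move=> ->; apply: (certified_step (cert0 _ 0)); left; apply: Or41.
- by move=> ->; apply: (certified_step (cert0 _ 0)); left; apply: Or42.
- by move=> ->; apply: (certified_step (cert0 _ 0)); left; apply: Or43.
- by move=> ->; apply: (certified_step (cert0 _ 0)); left; apply: Or44.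
- by move=> ->; apply: (certified_step (cert0 _ x.+1)); right; left; apply: Or41.
- move=> [u [v [/IHc [l [L [Lc cu]]] /IHd [l' [L' [Lc' dv]]] ->]]].
  apply: (certified_step (cert_cup Lc Lc')); right; left; apply: Or42.
  rewrite /= !cpairE; split=> //; exists u, v.
  by rewrite /entry !bit_cup -!/(entry _ _ _ _) cu dv orbT.
- move=> [u /IHd [l [L [Lc du]]] /IHc [l' [L' [Lc' cu]]]].
  apply: (certified_step (cert_cup Lc Lc')); right; left; apply: Or43.
  rewrite /= !cpairE; split=> //; exists u;
  by rewrite /entry !bit_cup -!/(entry _ _ _ _) ?cu ?du ?orbT.
- rewrite -/(pi1 x) -/(pi2 x) -[x in certified _ _ x _]pair_pi.
  elim: (pi2 x) y => [|n IHn] y.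
    move=> /IHc [l [L [Lc cu]]]; apply: (certified_step Lc); right; right.
    by rewrite /= !cpairE; split=> //; left.
  move=> [u /IHn [l [L [Lc cu]]] /IHd [l' [L' [Lc' du]]]].
  apply: (certified_step (cert_cup Lc Lc')); right; right.
  rewrite /= !cpairE; split=> //; right; split=> //; exists u;
  by rewrite /entry !bit_cup -!/(entry _ _ _ _) ?cu ?du ?orbT.
- move=> [/IHc [l [L [Lc cu]]] H].
  (* A minimisation needs the values at all arguments below [y]; their certificates are merged by
     induction on [y]. *)
  have [l' [L' [Lc' du]]] : exists l L, cert (fun i => i \in X) l L /\
      forall i, i < y -> exists u, entry L (encode c) (cpair x i) u.+1.
    elim: y H {cu} => [|y IHy] H; first by exists 0, 0; split=> //; exact: cert0.
    have [i iy|k [K [Kc ck]]] := IHy; first exact: H (ltnW iy).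
    have [u /IHc [k' [K' [Kc' cu]]]] := H y (ltnSn y).
    exists (maxn k k'), (cup K K'); split; first exact: cert_cup.
    move=> i; rewrite ltnS leq_eqVlt => /orP[/eqP ->|/ck [v cv]]; [exists u|exists v];
      by rewrite /entry bit_cup -!/(entry _ _ _ _) ?cu ?cv ?orbT.
  apply: (certified_step (cert_cup Lc Lc')); right; left; apply: Or44.
  rewrite /= !cpairE /entry !bit_cup -!/(entry _ _ _ _) cu; do 2?split=> //.
  by move=> i /du [u ceu]; exists u; rewrite bit_cup -!/(entry _ _ _ _) ceu orbT.
Qed.

(** The intermediate values may be searched below [L], because every output recorded in [L] is
    smaller than [L] ([entry_ltn]). *)
Definition stepb (O l L e x y : nat) : bool :=
  let e1 := pi1 (pi2 e) in let e2 := pi2 (pi2 e) in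
  let a := pi1 x in let n := pi2 x in
  [|| (e == cpair 0 0) && (y == 0),
      (e == cpair 1 0) && (y == x.+1),
      (e == cpair 2 0) && (y == pi1 x),
      (e == cpair 3 0) && (y == pi2 x),
      [&& e == cpair 4 0, x < l & y == nat_of_bool (bit O x)],
      (pi1 e == 5) && has (fun u => has (fun v =>
        [&& entry L e1 x u, entry L e2 x v & y == cpair u v]) (iota 0 L)) (iota 0 L),
      (pi1 e == 6) && has (fun u => entry L e2 x u && entry L e1 u y) (iota 0 L),
      [&& pi1 e == 8, entry L (pi2 e) (cpair x y) 0 &
        all (fun i => has (fun u => entry L (pi2 e) (cpair x i) u.+1) (iota 0 L))
          (iota 0 y)] |
      (pi1 e == 7) && ((n == 0) && entry L e1 a y ||
        (0 < n) && has (fun u => entry L e (cpair a n.-1) u &&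
                               entry L e2 (cpair a (cpair n.-1 u)) y) (iota 0 L))].

Lemma entry_ltn L e x y : entry L e x y -> y < L.
Proof.
move=> /bit_ltn; have := leq_pair2 e (cpair x y); have := leq_pair2 x y; lia.
Qed.

Lemma stepbP O l L e x y :
  reflect (step (bit O) l (entry L) e x y) (stepb O l L e x y).
Proof.
have hasE (P Q : nat -> bool) : (forall u, P u -> u < L) ->
    (exists u, P u /\ Q u) -> has (fun u => P u && Q u) (iota 0 L).
  by move=> PL [u [Pu Qu]]; apply/hasnP; exists u; [exact: PL | rewrite Pu].
apply: (iffP idP) => [|[[] [/eqP e1 /eqP e2]|[[]|[e7 s]]]]; rewrite /stepb.
- move=> /or4P[/andP[/eqP ? /eqP ?]|/andP[/eqP ? /eqP ?]|/andP[/eqP ? /eqP ?]|].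
  + by left; apply: Or41.
  + by left; apply: Or42.
  + by left; apply: Or43.
  case/or4P => [/andP[/eqP ? /eqP ?]|/and3P[/eqP ? ? /eqP ?]|/andP[/eqP e5 /hasnP[u _
    /hasnP[v _ /and3P[? ? /eqP ?]]]]|].
  + by left; apply: Or44.
  + by right; left; apply: Or41.
  + by right; left; apply: Or42; split=> //; exists u, v.
  case/or3P => [/andP[/eqP ? /hasnP[u _ /andP[? ?]]]|/and3P[/eqP ? ? /allnP
    H]|/andP[/eqP e7 H]].
  + by right; left; apply: Or43; split=> //; exists u.
  + by right; left; apply: Or44; do 2?split=> //; move=> i /H /hasnP [u _ ?]; exists u.
  + right; right; split=> //; case/orP: H => /andP[? H]; [left|right].
      by split=> //; apply/eqP.
    by split=> //; move/hasnP: H => [u _ /andP[? ?]]; exists u.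
- by rewrite e1 e2.
- by rewrite e1 e2 !orbT.
- by rewrite e1 e2 !orbT.
- by rewrite e1 e2 !orbT.
- by move=> [-> -> ->]; rewrite !eqxx !orbT.
- move=> [/eqP -> [u [v [Tu Tv ->]]]]; apply/orP; right; apply/orP; right; apply/orP; right.
  apply/orP; right; apply/orP; right; apply/orP; left => /=.
  apply/hasnP; exists u; first exact: entry_ltn Tu.
  by apply/hasnP; exists v; [exact: entry_ltn Tv | rewrite Tu Tv eqxx].
- move=> [/eqP -> [u Tu Ty]]; do 6 (apply/orP; right); apply/orP; left => /=.
  by apply/hasnP; exists u; [exact: entry_ltn Tu | rewrite Tu].
- move=> [/eqP -> [-> H]]; do 7 (apply/orP; right); apply/orP; left => /=.
  by apply/allnP => i /H [u Tu]; apply/hasnP; exists u => //; have := entry_ltn Tu; lia.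
- do 8 (apply/orP; right); rewrite e7 /=; case: s => [[-> ->]|[-> [u Tu Ty]]] //.
  by apply/orP; right; apply/hasnP; exists u; [exact: entry_ltn Tu | rewrite Tu].
Qed.

Definition certb O l L :=
  all (fun t => bit L t ==> stepb O l L (pi1 t) (pi1 (pi2 t)) (pi2 (pi2 t)))
    (iota 0 L).

Lemma certbP O l L : reflect (cert (bit O) l L) (certb O l L).
Proof.
apply: (iffP (allnP _ _)) => [H e x y T|H t _].
  by have := H _ (bit_ltn T); rewrite !cpairE (_ : bit _ _) //= => /stepbP.
by apply/implyP => Lt; apply/stepbP/H; rewrite /entry !pair_pi.
Qed.

Lemma dec_certb X fO fl fL :
    computes X fO -> computes X fl -> computes X fL ->
  dec X (fun z => certb (fO z) (fl z) (fL z)).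
Proof.
by move=> cO cl cL; rewrite /certb /stepb /entry; comp_auto.
Qed.

(** * Enumerability of forcing and of the partial recursive functions *)

Definition sigma2 X (A : nat -> nat -> Prop) :=
  sigma X (fun w => A (pi1 w) (pi2 w)).

Definition sigma3 X (A : nat -> nat -> nat -> Prop) :=
  sigma X (fun w => A (pi1 w) (pi1 (pi2 w)) (pi2 (pi2 w))).

Lemma sigma_app2 X A f g : sigma2 X A -> computes X f -> computes X g ->
  sigma X (fun z => A (f z) (g z)).
Proof.
move=> sA cf cg; have := sigma_app sA (comp_pair cf cg).
by apply: sigma_ext => z; rewrite !cpairE.
Qed.

Lemma sigma_app3 X A f g h :
    sigma3 X A -> computes X f -> computes X g -> computes X h ->
  sigma X (fun z => A (f z) (g z) (h z)).
Proof.
move=> sA cf cg ch; have := sigma_app sA (comp_pair cf (comp_pair cg ch)).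
by apply: sigma_ext => z; rewrite !cpairE.
Qed.

Ltac sigma_step :=
  cbv beta;
  match goal with
  | |- sigma2 _ _ => unfold sigma2
  | |- sigma3 _ _ => unfold sigma3
  | H : ?G |- ?G => exact H
  | H : sigma ?X ?A |- sigma ?X (fun z => ?A _) => apply: (sigma_app H)
  | H : sigma2 ?X ?A |- sigma ?X (fun z => ?A _ _) => apply: (sigma_app2 H)
  | H : sigma3 ?X ?A |- sigma ?X (fun z => ?A _ _ _) => apply: (sigma_app3 H)
  | |- sigma _ (fun z => _ /\ _) => apply: sigma_and
  | |- sigma _ (fun z => _ \/ _) => apply: sigma_or
  | |- sigma ?X (fun z => exists n, @?A z n) => apply: (@sigma_ex X A)
  | |- sigma ?X (fun z => is_true (@?P z)) => apply: (@sigma_dec X P)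
  | |- computes _ _ => comp_step
  | |- dec _ _ => comp_step
  | |- dec2 _ _ => comp_step
  end.
Ltac sigma_auto := repeat sigma_step.

(** The bound [l] is the use of the computation: below it, absence from [E] counts as a negative
    answer, so that [E] acts as a finite oracle. *)
Definition forces c E x y :=
  exists l, forall X : set nat,
    (forall i, i < l -> (i \in X) = bit E i) -> eval X c x y.

(** [E] is itself one of the oracles agreeing with [E], and the certificate of its computation
    serves all the others. This replaces the quantifier over oracles by a search. *)
Lemma forcesP c E x y :
  forces c E x y <-> exists l L, certb E l L /\ entry L (encode c) x y.
Proof.
split=> [[l H]|[l [L [/certbP EL cxy]]]]; last first.
  by exists l => X XE; exact: cert_sound EL XE cxy.
have XE i : (i \in [set i | bit E i]) = bit E i.
  by apply/idP/idP => [/set_mem|] //; exact: mem_set.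
have /cert_complete [l' [L [EL cxy]]] : eval [set i | bit E i] c x y by exact: H.
exists l', L; split=> //; apply/certbP => e a b /EL.
by have -> : (fun i => i \in [set i | bit E i]) = bit E by exact: funext XE.
Qed.

Lemma sigma_forces X c : sigma3 X (forces c).
Proof.
rewrite /sigma3.
apply: (@sigma_ext X (fun w => exists l L, certb (pi1 w) l L /\
    entry L (encode c) (pi1 (pi2 w)) (pi2 (pi2 w)))) => [w|].
  by rewrite forcesP.
do 2 apply: sigma_ex; apply: sigma_and; apply: sigma_dec; rewrite ?/entry; last by comp_auto.
by apply: dec_certb; comp_auto.
Qed.

Lemma eval_forces (X : set nat) c x y : eval X c x y ->
  exists l, forall E, (forall i, i < l -> (i \in X) = bit E i) -> forces c E x y.
Proof.
move=> /cert_complete [l [L [XL cxy]]]; exists l => E XE; exists l => Z ZE.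
by apply: cert_sound XL _ cxy => i il; rewrite ZE // XE.
Qed.

(** Programs that are never run by [cert] also have to be well-formed. *)
Definition code_step V e :=
  [|| e == cpair 0 0, e == cpair 1 0, e == cpair 2 0, e == cpair 3 0,
      e == cpair 4 0,
      [&& 5 <= pi1 e, pi1 e <= 7, bit V (pi1 (pi2 e)) & bit V (pi2 (pi2 e))] |
      (pi1 e == 8) && bit V (pi2 e)].

Definition codes V := all (fun e => bit V e ==> code_step V e) (iota 0 V).

Lemma codes_sound V e : codes V -> bit V e -> exists c, encode c = e.
Proof.
move=> /allnP VP; elim/ltn_ind: e => e IHe Ve.
have := VP e (bit_ltn Ve); rewrite Ve => /or4P[/eqP->|/eqP->|/eqP->|].
- by exists Zero.
- by exists Succ.
- by exists Fst.
case/or4P => [/eqP->|/eqP->|/and4P[e5 e7 V1 V2]|/andP[/eqP e8 V1]].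
- by exists Snd.
- by exists Query.
- have := leq_addpair (pi1 e) (pi2 e); have := leq_addpair (pi1 (pi2 e)) (pi2 (pi2 e)).
  rewrite !pair_pi => le2 le1.
  have [|c1 e1] := IHe _ _ V1; first lia.
  have [|c2 e2] := IHe _ _ V2; first lia.
  have : [\/ pi1 e = 5, pi1 e = 6 | pi1 e = 7].
    have : pi1 e < 8 by [].
    case: (pi1 e) e5 => [|[|[|[|[|[|[|[|n]]]]]]]] //;
      by [constructor 1|constructor 2|constructor 3].
  case=> e0; [exists (Pair c1 c2)|exists (Comp c1 c2)|exists (Prec c1 c2)];
    by rewrite /= e1 e2 pair_pi -e0 pair_pi.
have := leq_addpair (pi1 e) (pi2 e); rewrite pair_pi => le1.
have [|c1 e1] := IHe _ _ V1; first lia.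
by exists (Mu c1); rewrite /= e1 -e8 pair_pi.
Qed.

Lemma codes_complete c : exists V, codes V /\ bit V (encode c).
Proof.
have stepS V W e : (forall i, bit V i -> bit W i) -> code_step V e -> code_step W e.
  move=> VW /or4P[/eqP->|/eqP->|/eqP->|]; rewrite /code_step ?eqxx ?orbT //.
  case/or4P => [/eqP->|/eqP->|/and4P[-> -> /VW -> /VW ->]|/andP[-> /VW ->]];
  by rewrite ?eqxx ?orbT.
have codesU V W : codes V -> codes W -> codes (cup V W).
  move=> /allnP VP /allnP WP; apply/allnP => e _; apply/implyP.
  rewrite bit_cup => /orP[Ve|We].
    have := VP e (bit_ltn Ve); rewrite Ve; apply: stepS => i.
    by rewrite bit_cup => ->.
  have := WP e (bit_ltn We); rewrite We; apply: stepS => i.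
  by rewrite bit_cup orbC => ->.
have codesA V e : codes V -> code_step V e -> exists V, codes V /\ bit V e.
  move=> /allnP VP eP; exists (adjoin V e).
  have VA i : bit V i -> bit (adjoin V e) i by rewrite bit_adjoin => ->.
  rewrite bit_adjoin eqxx orbT; split=> //; apply/allnP => k _; apply/implyP.
  rewrite bit_adjoin => /orP[Vk|/eqP ->]; last exact: stepS eP.
  by have := VP k (bit_ltn Vk); rewrite Vk; exact: stepS.
elim: c => [||||| c [V [cV Vc]] d [W [cW Wd]] | c [V [cV Vc]] d [W [cW Wd]] |
   c [V [cV Vc]] d [W [cW Wd]] | c [V [cV Vc]]].
1-5: by apply: (codesA 0) => //=; rewrite /code_step ?eqxx ?orbT.
1-3: by apply: (codesA _ _ (codesU _ _ cV cW));
  rewrite /code_step /= !cpairE !bit_cup Vc Wd !orbT.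
by apply: (codesA _ _ cV); rewrite /code_step /= !cpairE Vc !orbT.
Qed.

Lemma phiP e x y : phi e x y <->
  exists V l L, [/\ codes V, bit V e, certb 0 l L & entry L e x y].
Proof.
split=> [[c <- /cert_complete [l [L [EL cxy]]]]|[V [l [L [cV Ve /certbP L0 exy]]]]].
  have [V [cV Vc]] := codes_complete c; exists V, l, L; split=> //.
  apply/certbP => e' a b /EL.
  have -> // : (fun i => i \in set0) = bit 0.
  by apply: funext => i; rewrite bit_0; apply/negP => /set_mem.
have [c ce] := codes_sound cV Ve; exists c => //.
apply: cert_sound L0 _ _; last by rewrite ce.
by move=> i _; rewrite bit_0; apply/negP => /set_mem.
Qed.

Lemma sigma_phi X : sigma3 X phi.
Proof.
rewrite /sigma3.
apply: (@sigma_ext X (fun w => exists V l L, (codes V && bit V (pi1 w)) &&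
    (certb 0 l L && entry L (pi1 w) (pi1 (pi2 w)) (pi2 (pi2 w))))) => [w|].
  rewrite phiP; split=> -[V [l [L]]]; last first.
    by move=> [c1 c2 c3 c4]; exists V, l, L; rewrite c1 c2 c3.
  by move=> /andP[/andP[? ?] /andP[? ?]]; exists V, l, L.
do 3 apply: sigma_ex; apply: sigma_dec; apply: dec_and; rewrite ?/codes ?/code_step ?/entry.
  by comp_auto.
by apply: dec_and; [apply: dec_certb; comp_auto | comp_auto].
Qed.

(** Otherwise the first [b] found to satisfy [V x b] would define, as a function
    of [x], a diagonally nonrecursive function. *)
Lemma nonPA_diagonal X (V : nat -> nat -> Prop) :
    ~ PA_degree X -> sigma2 X V -> (forall x, exists b : bool, V x b) ->
  exists x (b : bool), phi x x b /\ V x b.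
Proof.
move=> nPA [D cD DV] exV.
(* The search runs over pairs: the parity of the first component is the guessed bit, and the second
   component is a stage of the enumeration. *)
have exD x : exists s, D (cpair x (nat_of_bool (odd (pi1 s)))) (pi2 s).
  have [b /[dup] Vxb] := exV x.
  have /DV [s Ds] : V (pi1 (cpair x (nat_of_bool b))) (pi2 (cpair x (nat_of_bool b)))
    by rewrite !cpairE.
  by exists (cpair (nat_of_bool b) s); rewrite !cpairE oddb.
apply: contrapT => noxb; apply: nPA.
pose s x := ex_minn (exD x).
exists (fun x => odd (pi1 (s x))).
  apply: dec_odd; apply: comp_pi1.
  apply: (@comp_mu X (fun x s => D (cpair x (nat_of_bool (odd (pi1 s)))) (pi2 s)) exD).
  by comp_auto.
move=> e y ey hy; apply: noxb; exists e, (odd (pi1 (s e))); split; first by rewrite hy.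
have := (DV (cpair e (nat_of_bool (odd (pi1 (s e)))))).2; rewrite !cpairE; apply.
by exists (pi2 (s e)); rewrite /s; case: ex_minnP.
Qed.

(** The one-fold statement is applied to [y] for fixed [x], and then to [x] with
    the enumerable predicate "some [y] is already as required". *)
Lemma nonPA_diagonal2 X (V : nat -> nat -> nat -> nat -> Prop) :
    ~ PA_degree X ->
    sigma2 X (fun p q => V (pi1 p) (pi2 p) (pi1 q) (pi2 q)) ->
    (forall x y, exists b c : bool, V x b y c) ->
  exists x y (b c : bool), [/\ phi x x b, phi y y c & V x b y c].
Proof.
move=> nPA sV exV.
pose W x b := exists q, phi (pi1 q) (pi1 q) (pi2 q) /\
  ((pi2 q <= 1) /\ V x b (pi1 q) (pi2 q)).
have sW : sigma2 X W.
  have sp := sigma_phi X.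
  rewrite /W; rewrite /sigma2; apply: sigma_ex; sigma_auto.
have [|x [b [xb [q [qP [q1 Vq]]]]]] := nonPA_diagonal nPA sW.
  move=> x; have [||y [c [yc [b Vb]]]] := @nonPA_diagonal X
      (fun y c => exists b, b <= 1 /\ V x b y c) nPA.
  - rewrite /sigma2; apply: sigma_ex; apply: sigma_and; first by apply: sigma_dec; comp_auto.
    apply: sigma_ext (sigma_app2 sV (f := fun w => cpair x (pi2 w)) (g := fun w => pi1 w) _ _);
      [by move=> w /=; rewrite !cpairE | comp_auto..].
  - by move=> y; have [b [c Vbc]] := exV x y; exists c, b; split=> //; case: (b).
  exists (b == 1), (cpair y (nat_of_bool c)); rewrite !cpairE; split=> //; split;
    first by case: (c).
  by case: Vb; case: b => [|[|b]].
exists x, (pi1 q), b, (pi2 q == 1); suff -> : nat_of_bool (pi2 q == 1) = pi2 q by [].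
by case: (pi2 q) q1 => [|[|k]].
Qed.

(** * Liu's theorem on partitions *)

Lemma code_exists (P : nat -> bool) n :
  (forall i, P i -> i < n) -> exists w, bit w =1 P.
Proof.
move=> Pn; exists (code_of n P) => i.
by rewrite bit_code_of; case: (boolP (P i)) => [/Pn ->|]; rewrite ?andbF.
Qed.

Definition inset (D : nat) (Z : set nat) := forall i, bit D i -> Z i.

(** Compactness is applied to the set [Q] of the pairs [(l, y)] with [chi y = l]. An arbitrary [Q]
    either leaves some [y] without a color, which the finite set [b] witnesses, or contains the
    graph of a coloring. *)
Lemma sigma_coloring Y n L (H : nat -> nat -> nat -> Prop) :
    (forall l, l < L -> sigma2 Y (H l)) ->
  sigma Y (fun p => forall chi : nat -> nat,
    (forall y, Y y -> n <= y -> chi y < L) ->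
    exists l D, [/\ l < L, forall i, bit D i -> [/\ Y i, n <= i & chi i = l]
                  & H l p D]).
Proof.
move=> sH.
pose R p a b := (exists y, [&& y \in Y, n <= y &
    all (fun l => bit b (cpair l y)) (iota 0 L)]) \/
  (exists2 l, l < L & exists D, all (fun i => bit D i ==>
    [&& i \in Y, n <= i & bit a (cpair l i)]) (iota 0 D) /\ H l p D).
suff /sigma_compact : sigma3 Y R.
  apply: sigma_ext => p; split=> [RP chi chiL|HP Q].
    have [a [b [aQ bQ]]] := RP [set k | chi (pi2 k) = pi1 k].
    case=> [[y /and3P[/set_mem Yy ny /allnP bL]]|[l lL [D [/allnP DP HlD]]]].
      have /bQ := bL _ (chiL y Yy ny).
      by rewrite /= !cpairE.
    exists l, D; split=> // i Di; have := DP i (bit_ltn Di).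
    by rewrite Di => /and3P[/set_mem Yi ni /aQ]; rewrite /= !cpairE.
  have [[y [Yy ny noQ]]|allQ] := pselect (exists y, [/\ Y y, n <= y &
      forall l, l < L -> ~ Q (cpair l y)]).
    have [b bP] : exists b, bit b =1 fun k => (pi2 k == y) && (pi1 k < L).
      apply: (@code_exists _ (\max_(l < L) cpair (l : nat) y).+1) => k /andP[/eqP <- kL].
      by rewrite ltnS -[leqLHS](pair_pi k) (leq_bigmax (Ordinal kL)).
    exists 0, b; split=> [i|i|]; first by rewrite bit_0.
      by rewrite bP => /andP[/eqP iy iL]; have := noQ _ iL; rewrite -iy pair_pi.
    left; exists y; rewrite ny (mem_set Yy) /=; apply/allnP => l lL.
    by rewrite bP !cpairE eqxx.
  have /choice [chi chiP] : forall y, exists l, Y y -> n <= y -> l < L /\ Q (cpair l y).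
    move=> y; apply: contrapT => noL; apply: allQ; exists y.
    have [Yy ny] : Y y /\ n <= y.
      by split; apply: contrapT => h; apply: noL; exists 0.
    by split=> // l lL Ql; apply: noL; exists l.
  have [|l [D [lL DP HlD]]] := HP chi; first by move=> y Yy ny; have [] := chiP y Yy ny.
  have [a aP] : exists a, bit a =1 fun k => (pi1 k == l) && bit D (pi2 k).
    apply: (@code_exists _ (\max_(i < D) cpair l (i : nat)).+1) => k /andP[/eqP <- /bit_ltn kD].
    by rewrite ltnS -[leqLHS](pair_pi k) (leq_bigmax (Ordinal kD)).
  exists a, 0; split=> [k|k|]; last 1 first.
  - right; exists l => //; exists D; split=> //; apply/allnP => i _; apply/implyP => Di.
    by have [Yi ni _] := DP i Di; rewrite (mem_set Yi) ni aP !cpairE eqxx.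
  - rewrite aP => /andP[/eqP kl /DP [Yk nk ck]].
    by have [_] := chiP _ Yk nk; rewrite ck -kl pair_pi.
  - by rewrite bit_0.
rewrite /sigma3 /R; apply: sigma_or.
  apply: sigma_ex; apply: sigma_dec; comp_auto.
apply: (@sigma_finite_or Y (fun l w => exists D, all (fun i => bit D i ==>
    [&& i \in Y, n <= i & bit (pi1 (pi2 w)) (cpair l i)]) (iota 0 D) /\ H l (pi1 w) D)).
move=> l /sH sHl; apply: sigma_ex; apply: sigma_and; last by sigma_auto.
by apply: sigma_dec; comp_auto.
Qed.

(** These are the requirements met by both forcing constructions: each program agrees somewhere with
    the diagonal function, or somewhere has no Boolean value. *)
Lemma nonPA_of (G : set nat) :
    (forall c, (exists x (b : bool), phi x x b /\ eval G c x b) \/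
               (exists x, forall b : bool, ~ eval G c x b)) ->
  ~ PA_degree G.
Proof.
move=> GP [h [c ch] hP].
case: (GP c) => [[x [b [xb cxb]]]|[x nox]]; last exact: nox (ch x).
by apply: (hP x b xb); exact: eval_functional (ch x) cxb.
Qed.

Lemma generic_sequence T (R : T -> T -> Prop) (Den : nat -> T -> Prop) (x0 : T) :
    (forall n x, exists2 y, R x y & Den n y) ->
  exists s : nat -> T, [/\ s 0 = x0, forall n, R (s n) (s n.+1) &
                           forall n, Den n (s n.+1)].
Proof.
move=> step; pose f n x := cid2 (step n x).
exists (fun n => iteri n (fun n x => s2val (f n x)) x0).
by split=> // n /=; case: (f _ _).
Qed.

Lemma code_enum : exists e : nat -> code, forall c, exists n, e n = c.
Proof.
have /choice [e eP] : forall n, exists c, (exists2 d, encode d = n & True) -> encode c = n.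
  move=> n; have [[d dn _]|no] := pselect (exists2 d, encode d = n & True).
    by exists d.
  by exists Zero.
exists e => c; exists (encode c); apply: encode_inj; apply: eP.
by exists c.
Qed.

(** For [B] r.e. in [Y], the sets avoiding [B] form a class that is Pi^0_1 in [Y] and closed under
    subsets. *)
Definition avoid (B : nat -> Prop) (Z : set nat) := forall D, inset D Z -> ~ B D.

Lemma avoid_sub B Z Z' : Z `<=` Z' -> avoid B Z' -> avoid B Z.
Proof. by move=> ZZ' ZB D DZ; apply: ZB => i /DZ /ZZ'. Qed.

(** The ideal generated by the finite sets and by the sets that avoid some
    member of [M]. *)
Inductive small (M : set (nat -> Prop)) : set nat -> Prop :=
| small_finite n (S : set nat) : (forall i, S i -> i < n) -> small M S
| small_cons B Z (S : set nat) :
    M B -> avoid B Z -> small M (S `\` Z) -> small M S.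

Section Small.
Variable M : set (nat -> Prop).

Lemma small_sub S S' : S `<=` S' -> small M S' -> small M S.
Proof.
move=> SS' S's; elim: S's S SS' => [n {}S' S'n|B Z {}S' MB ZB _ IH] S SS'.
  by apply: (@small_finite _ n) => i /SS' /S'n.
by apply: (small_cons MB ZB); apply: IH => x [/SS'].
Qed.

Lemma small_setU S S' : small M S -> small M S' -> small M (S `|` S').
Proof.
elim=> [n {}S Sn|B Z {}S MB ZB _ IH] S's; last first.
  apply: (small_cons MB ZB); apply: small_sub (IH S's).
  by move=> x [[Sx|S'x] nZ]; [left|right].
elim: S's => [m {}S' S'm|B Z {}S' MB ZB _ IH].
  by apply: (@small_finite _ (maxn n m)) => i [/Sn|/S'm]; lia.
apply: (small_cons MB ZB); apply: small_sub IH.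
by move=> x [[Sx|S'x] nZ]; [left|right].
Qed.

Lemma small_avoid B Z : M B -> avoid B Z -> small M Z.
Proof.
move=> MB ZB; apply: (small_cons MB ZB).
by apply: (@small_finite _ 0) => i [].
Qed.

Lemma small_color S (chi : nat -> nat) L :
    ~ small M S -> (forall x, S x -> chi x < L) ->
  exists2 l, l < L & ~ small M (S `&` [set x | chi x = l]).
Proof.
elim: L S => [|L IHL] S nS chiL.
  by case: nS; apply: (@small_finite _ 0) => i /chiL.
have [sL|nL] := pselect (small M (S `&` [set x | chi x = L])); last by exists L.
have [||l lL nl] := IHL (S `&` [set x | chi x <> L]).
- move=> sN; apply: nS; apply: small_sub (small_setU sL sN) => x Sx.
  by have [e|e] := pselect (chi x = L); [left|right].
- by move=> x [/chiL + /eqP]; rewrite ltnS leq_eqVlt => /orP[->|].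
exists l; first exact: ltnW.
by apply: contra_not nl; apply: small_sub => x [[]].
Qed.

(** Unfolds a derivation of smallness into a finite cover, whose members can then serve as
    colors. *)
Lemma small_family S : small M S -> exists k (Bs : nat -> nat -> Prop) Zs n,
  (forall i, i < k -> M (Bs i) /\ avoid (Bs i) (Zs i)) /\
  (forall x, S x -> n <= x -> exists2 i, i < k & Zs i x).
Proof.
elim=> [n {}S Sn|B Z {}S MB ZB _ [k [Bs [Zs [n [BZ SZ]]]]]].
  by exists 0, (fun=> xpredT), (fun=> set0), n; split=> // x /Sn; lia.
exists k.+1, (fun i => if i is j.+1 then Bs j else B),
  (fun i => if i is j.+1 then Zs j else Z), n; split=> [[|i] // ik|x Sx nx].
  exact: BZ.
have [Zx|nZ] := pselect (Z x); first by exists 0.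
by have [//|i ik Zi] := SZ x _ nx; exists i.+1.
Qed.

End Small.

Lemma small_mono (M M' : set (nat -> Prop)) S : M `<=` M' -> small M S -> small M' S.
Proof.
move=> MM'; elim=> [n {}S Sn|B Z {}S MB ZB _ IH]; first exact: small_finite Sn.
exact: small_cons (MM' _ MB) ZB IH.
Qed.

(** A derivation of smallness mentions finitely many members of the union, and these lie in a single
    element of the chain. If it mentions none, [S] is finite, which is the only possibility for an
    empty chain. *)
Lemma small_chain (F : set (set (nat -> Prop))) S :
    total_on F subset -> small (\bigcup_(M in F) M) S ->
  finite_set S \/ exists2 M, F M & small M S.
Proof.
move=> Ft; elim=> [n {}S Sn|B Z {}S [M1 FM1 M1B] ZB _ IH].
  by left; apply: sub_finite_set (finite_II n).
right; case: IH => [fin|[M2 FM2 sm]].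
  exists M1 => //; apply: (small_cons M1B ZB).
  have /finite_fsetP [X eX] := fin.
  apply: (@small_finite _ (\max_(i <- enum_fset X) i).+1) => i; rewrite eX => iX.
  by rewrite ltnS; apply: (@leq_bigmax_seq _ (enum_fset X) xpredT id).
case: (Ft _ _ FM1 FM2) => [le|le].
  by exists M2 => //; apply: small_cons (le _ M1B) ZB sm.
by exists M1 => //; apply: small_cons M1B ZB (small_mono le sm).
Qed.

(** The sets that a derivation removes on account of the new member [B] are collected in [Zs]; its
    other steps show the remainder to be small for [M]. *)
Lemma small_add M B S : small (M `|` [set B]) S -> exists u Zs,
  (forall i, i < u -> avoid B (Zs i)) /\
  small M (S `&` [set x | forall i, i < u -> ~ Zs i x]).
Proof.
elim=> [n {}S Sn|B' Z {}S MB' ZB _ [u [Zs [Zsa sm]]]].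
  by exists 0, (fun=> set0); split=> //; apply: (@small_finite _ n) => i [/Sn].
case: MB' => [MB'|/= eB]; last subst B'.
  exists u, Zs; split=> //; apply: (small_cons MB' ZB).
  by apply: small_sub sm => x [[Sx nx] nZ].
exists u.+1, (fun i => if i is j.+1 then Zs j else Z); split=> [[|i] //|].
  exact: Zsa.
apply: small_sub sm => x [Sx nx]; split; first by split=> //; exact: (nx 0).
by move=> i iu; exact: (nx i.+1).
Qed.

(** Zorn's lemma. Since [Y] is infinite, [small_chain] lets every chain, the empty one included,
    have its union as an upper bound. *)
Lemma exists_maximal (Y : set nat) : infinite_set Y ->
  exists M, [/\ forall B, M B -> sigma Y B, ~ small M Y &
    forall B, sigma Y B -> ~ M B -> small (M `|` [set B]) Y].
Proof.
move=> Yinf.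
have [|M [[Ms nM] Mmax]] := @Zorn_bigcup _
    [set M | (forall B, M B -> sigma Y B) /\ ~ small M Y].
  move=> F FP Ft; split; first by move=> B [M /FP [Ms _] /Ms].
  by move=> /(small_chain Ft) [//|[M /FP [_ nM]]].
exists M; split=> // B sB nB; apply: contrapT => nsm.
apply: (Mmax (M `|` [set B])); last by split=> // B' [/Ms//|->].
rewrite properEneq; split; last by left.
by apply/eqP => e; apply: nB; rewrite e; right.
Qed.

(** A set [Z] avoids [shift B D] iff [Z] together with [D] avoids [B]. *)
Definition shift (B : nat -> Prop) D E := exists E', sub_bit E' (cup E D) /\ B E'.

Lemma sigma_shift Y B D : sigma Y B -> sigma Y (shift B D).
Proof.
move=> sB; apply: (@sigma_ex Y (fun E E' => sub_bit E' (cup E D) /\ B E')).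
apply: sigma_and; last by sigma_auto.
apply: sigma_dec; apply: dec_all; last by comp_auto.
apply: dec_implb; apply: dec_bit; try by comp_auto.
by apply: comp_cup; comp_auto.
Qed.

Section Partition.
Variables (Y : set nat) (M : set (nat -> Prop)) (A : bool -> set nat).
Hypotheses (nPA : ~ PA_degree Y) (Msigma : forall B, M B -> sigma Y B).
Hypothesis (nM : ~ small M Y).
Hypothesis (Mmax : forall B, sigma Y B -> ~ M B -> small (M `|` [set B]) Y).
Hypotheses (nA : forall t, ~ small M (A t)) (AY : forall t, A t `<=` Y).
Hypothesis Acover : small M (Y `\` (A true `|` A false)).

(** For a least possible number [u] of sets, no [shift B D] with [D] inside one of
    them is in [M], as this set could be dropped otherwise. *)
Lemma large_cover B : sigma Y B -> ~ M B -> exists u Zs,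
  [/\ forall i, i < u -> avoid B (Zs i),
      small M (Y `&` [set x | forall i, i < u -> ~ Zs i x]) &
      forall v D, v < u -> inset D (Zs v) -> ~ M (shift B D)].
Proof.
move=> sB nB; pose P u := exists Zs, (forall i, i < u -> avoid B (Zs i)) /\
  small M (Y `&` [set x | forall i, i < u -> ~ Zs i x]).
have exP : exists u, `[< P u >].
  by have [u Pu] := small_add (Mmax sB nB); exists u; apply/asboolP.
case: (ex_minnP exP) => u /asboolP [Zs [Za Zsmall]] umin.
exists u, Zs; split=> // v D vu DZ MBD.
case: u Za Zsmall umin vu => // u Za Zsmall umin vu.
suff /asboolP /umin : P u by rewrite ltnn.
(* [Zs v] is dropped and the last set takes its place: [Zs v] avoids [shift B D], which is in [M],
   so it is small. *)
exists (fun i => if i == v then Zs u else Zs i); split.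
  by move=> i iu; case: eqP => _; apply: Za; rewrite // ltnW.
apply: small_sub (small_setU Zsmall (small_avoid (Z := Zs v) MBD _)) => [x [Yx nx]|];
  last first.
  move=> E EZ [E' [/sub_bitP E'E BE']]; apply: (Za v vu E' _ BE') => i /E'E.
  by rewrite bit_cup => /orP[/EZ|/DZ].
have [Zvx|nZv] := pselect (Zs v x); [by right|left]; split=> // i.
rewrite ltnS leq_eqVlt => /orP[/eqP ->|iu].
  have [e|/eqP nvu] := pselect (v = u); first by rewrite -e.
  by have := nx v; rewrite eqxx; apply; move: vu nvu; lia.
have [->//|/eqP nvi] := pselect (i = v).
by have := nx i iu; rewrite (negbTE nvi).
Qed.

(** No set avoids a [B] that contains the empty set, coded by 0. The cover from [large_cover] would
    have no members, and [Y] would be small. *)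
Lemma large0 B : sigma Y B -> ~ M B -> ~ B 0.
Proof.
move=> sB nB; have [[|u] [Zs [Za Zsm _]]] := large_cover sB nB.
  by case: nM; apply: small_sub Zsm => x Yx; split=> // i.
by apply: (Za 0) => // i; rewrite bit_0.
Qed.

(** In the Mathias-style condition, [fin t] is the part of the [t]-th generic set
    below [len], and all sets avoiding [bad] are possible reservoirs. *)
Record cond := Cond { fin : bool -> nat; len : nat; bad : nat -> Prop }.

Definition good c := [/\ sigma Y (bad c), ~ M (bad c) &
  forall t i, bit (fin c t) i -> A t i /\ i < len c].

(** By the third clause, the elements added on both sides and any new reservoir jointly form a
    reservoir of the old condition. *)
Definition ext c c' :=
  [/\ len c <= len c',
      forall t i, i < len c -> bit (fin c' t) i = bit (fin c t) i &
      forall Z, avoid (bad c') Z -> avoid (bad c)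
        (Z `|` [set i | exists t, bit (fin c' t) i /\ ~~ bit (fin c t) i])].

Lemma ext_refl c : ext c c.
Proof.
split=> // Z; apply: avoid_sub => i [//|[t [ci]]]; by rewrite ci.
Qed.

Lemma ext_trans c1 c2 c3 : ext c1 c2 -> ext c2 c3 -> ext c1 c3.
Proof.
move=> [l12 F12 B12] [l23 F23 B23]; split=> [|t i il|Z /B23 /B12].
- exact: leq_trans l23.
- by rewrite F23 ?F12 //; exact: leq_trans l12.
apply: avoid_sub => i [Zi|[t [i3 i1]]]; first by left; left.
by case: (boolP (bit (fin c2 t) i)) => i2; [right | left; right]; exists t.
Qed.

Lemma ext_adjoin c t D l :
    good c -> inset D (A t) -> (forall i, bit D i -> len c <= i < l) ->
    ~ M (shift (bad c) D) -> len c <= l ->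
  let c' := Cond (fun s => if s == t then cup (fin c t) D else fin c s) l
                 (shift (bad c) D) in
  good c' /\ ext c c'.
Proof.
move=> [sB nB cA] DA Dl nMD cl; split; split=> //=; first exact: sigma_shift.
- move=> s i; case: eqP => [->|_ /cA [? ?]]; last by split=> //; exact: leq_trans cl.
  rewrite bit_cup => /orP[/cA [? ?]|Di]; first by split=> //; exact: leq_trans cl.
  by split; [exact: DA | have /andP[] := Dl i Di].
- move=> s i il; case: eqP => // ->; rewrite bit_cup orb_idr // => /Dl.
  by rewrite leqNgt il.
move=> Z ZB E EZ BE.
(* [E0] is [E] without [D]. It lies in [Z], and it is in [shift (bad c) D] because [E] is in
   [bad c]. *)
have [E0 E0P] : exists E0, bit E0 =1 fun i => bit E i && ~~ bit D i.
  by apply: (@code_exists _ E) => i /andP[/bit_ltn].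
apply: (ZB E0) => [i|]; last first.
  exists E; split=> //; apply/sub_bitP => i Ei; rewrite bit_cup E0P Ei.
  by case: (bit D i).
rewrite E0P => /andP[Ei nDi]; case: (EZ i Ei) => // -[s []].
by case: eqP => [->|_]; [rewrite bit_cup (negbTE nDi) orbF => -> | move=> ->].
Qed.

(** As [A t] is not small, it meets a member of the cover from [large_cover] beyond any bound, and
    the cover permits the shift by a singleton taken there. *)
Lemma growth c t n : good c ->
  exists c', [/\ good c', ext c c' & exists2 i, n <= i & bit (fin c' t) i].
Proof.
move=> gc; have [sB nB _] := gc; have [u [Zs [Za Zsm Zl]]] := large_cover sB nB.
have [i [v [Ai vu Zvi ni]]] : exists i v,
    [/\ A t i, v < u, Zs v i & n + len c <= i].
  apply: contrapT => noi; apply: (nA (t := t)).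
  apply: small_sub (small_setU Zsm (@small_finite M (n + len c) `I_(n + len c) _)) => // i Ai.
  case: (ltnP i (n + len c)) => il; [by right|left]; split; first exact: AY Ai.
  by move=> v vu Zvi; apply: noi; exists i, v.
have DE j : bit (2 ^ i) j -> j = i by rewrite bit_pow2 => /eqP.
have [||||gc' ec'] := @ext_adjoin c t (2 ^ i) i.+1 gc.
- by move=> j /DE ->.
- by move=> j /DE ->; rewrite ltnSn; move: ni; lia.
- by apply: Zl vu _ => j /DE ->.
- by move: ni; lia.
eexists; split; [exact: gc' | exact: ec' | exists i; first by move: ni; lia].
by rewrite /= eqxx bit_cup bit_pow2 eqxx orbT.
Qed.

(** The second alternative excludes Boolean values at [x], because the elements added to the stem
    later form a set outside [bad c]. *)
Definition sat c (d : code) t :=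
  (exists x (b : bool), phi x x b /\ forall X : set nat,
     (forall i, i < len c -> (i \in X) = bit (fin c t) i) -> eval X d x b) \/
  (exists x, forall D (b : bool), forces d (cup (fin c t) D) x b -> bad c D).

(** If [x] admits no extension with a value of [d t] as desired, then each of
    three colorings, for different pairs of desired values, has no suitable
    monochromatic set; two of the three put the same side on a given element,
    and on this side the computation must diverge. *)
Lemma decide c (d : bool -> code) : good c ->
  exists c' t, [/\ good c', ext c c' & sat c' (d t) t].
Proof.
move=> gc; have [sB nB cA] := gc.
have [u [Zs [Za Zsm Zl]]] := large_cover sB nB.
have [k [Bs [Z' [n [BZ SZ]]]]] := small_family (small_setU Zsm Acover).
(* Color [v.*2 + t] is intended for the elements of [Zs v] on the side [t], color [u.*2 + j] for
   those of [Z' j], where [Z'] covers the small remainder. *)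
pose m := n + len c; pose L := u.*2 + k.
pose trig t z D := forces (d t) (cup (fin c t) D) (pi1 (pi1 z)) (pi2 (pi1 z)) \/
                   forces (d t) (cup (fin c t) D) (pi1 (pi2 z)) (pi2 (pi2 z)).
pose H l z D := if l < u.*2 then bad c D \/ trig (odd l) z D else Bs (l - u.*2) D.
pose W z := forall chi : nat -> nat, (forall y, Y y -> m <= y -> chi y < L) ->
  exists l D, [/\ l < L, forall i, bit D i -> [/\ Y i, m <= i & chi i = l] & H l z D].
have sW : sigma Y W.
  apply: sigma_coloring => l lL; rewrite /sigma2 /H; case: ltnP => lu; last first.
    have sBs : sigma Y (Bs (l - u.*2)).
      by apply: Msigma; apply: (BZ _ _).1; move: lL; rewrite /L; lia.
    by sigma_auto.
  apply: sigma_or; first by sigma_auto.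
  have cc : computes Y (fun w => cup (fin c (odd l)) (pi2 w)) by apply: comp_cup; comp_auto.
  by apply: sigma_or; apply: (sigma_app3 (sigma_forces Y (d (odd l))));
    rewrite // -/(computes _ _); comp_auto.
pose V x b y e := W (cpair (cpair x b) (cpair y e)).
have sV : sigma2 Y (fun p q => V (pi1 p) (pi2 p) (pi1 q) (pi2 q)).
  by rewrite /sigma2 /V; sigma_auto.
have [exV|noV] := pselect (forall x y, exists b e : bool, V x b y e).
  have [x [y [b [e [xb ye Vxy]]]]] := nonPA_diagonal2 nPA sV exV.
  (* [W] is applied to the intended coloring. A set of color at least [u.*2] is excluded by [BZ],
     and one in [bad c] by [Za], so that a computation is forced inside some [Zs v] on one side. *)
  have /choice [chi chiP] : forall i, exists l, Y i -> m <= i -> l < L /\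
      if l < u.*2 then Zs l./2 i /\ A (odd l) i else Z' (l - u.*2) i.
    move=> i; have [[Yi mi]|no] := pselect (Y i /\ m <= i); last first.
      by exists 0 => Yi mi; case: no.
    have ni : n <= i by move: mi; rewrite /m; lia.
    have [[v [vu Zvi [t Ati]]]|nov] := pselect (exists v, [/\ v < u, Zs v i & exists t, A t i]).
      exists (v.*2 + t) => _ _; have vt : v.*2 + t < u.*2 by case: (t); move: vu; lia.
      rewrite vt; split; first by rewrite /L; lia.
      by rewrite oddD odd_double oddb addbC halfD odd_double doubleK; case: (t) Ati =>
        /=; rewrite ?addn0.
    have [||j jk Zj] := SZ i => //.
      have [[t Ati]|noA] := pselect (exists t, A t i); [left|right]; split=> //.
        by move=> v vu Zvi; apply: nov; exists v; split=> //; exists t.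
      by move=> [Ai|Ai]; apply: noA; eexists; exact: Ai.
    exists (u.*2 + j) => _ _; rewrite ltn_add2l jk ltnNge leq_addr /=.
    by rewrite addKn.
  have [|l [D [lL DP]]] := Vxy chi; first by move=> i Yi mi; have [] := chiP i Yi mi.
  have DZ i : bit D i -> if l < u.*2 then Zs l./2 i /\ A (odd l) i else Z' (l - u.*2) i.
    by move=> /DP [Yi mi <-]; have [] := chiP i Yi mi.
  rewrite /H; move: DZ; case: ltnP => lu DZ; last first.
    have lk : l - u.*2 < k by move: lL; rewrite /L; lia.
    by move=> BD; case: ((BZ _ lk).2 D).
  have lu' : l./2 < u by lia.
  case=> [bD|]; first by case: (Za _ lu' D) => // i /DZ [].
  rewrite /trig !cpairE; set t := odd l => ft.
  have {ft} [x' [b' [xb' [l0 fl0]]]] : exists x (b : bool), phi x x b /\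
      forces (d t) (cup (fin c t) D) x b by case: ft; [exists x, b|exists y, e].
  have [||||gc' ec'] := @ext_adjoin c t D (maxn (len c) (D + l0)) gc.
  - by move=> i /DZ [].
  - move=> i Di; have [_ mi _] := DP i Di; have := bit_ltn Di.
    by move: mi; rewrite /m; lia.
  - by apply: Zl lu' _ => i /DZ [].
  - exact: leq_maxl.
  eexists; exists t; split; [exact: gc' | exact: ec' | left; exists x', b'; split=> //].
  move=> X /= XE; apply: fl0 => i il0; rewrite XE ?eqxx //.
  by rewrite leq_max; apply/orP; right; lia.
have [x [y nV]] : exists x y, forall b e : bool, ~ V x b y e.
  apply: contrapT => no; apply: noV => x y; apply: contrapT => no'; apply: no.
  by exists x, y => b e Vb; apply: no'; exists b, e.
have /choice [chi chiP] : forall be : bool * bool, exists chi : nat -> nat,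
    (forall i, Y i -> m <= i -> chi i < L) /\
    forall l D, l < L -> (forall i, bit D i -> [/\ Y i, m <= i & chi i = l]) ->
      ~ H l (cpair (cpair x (nat_of_bool be.1)) (cpair y (nat_of_bool be.2))) D.
  move=> [b e]; apply: contrapT => no; apply: (nV b e) => chi chiL.
  apply: contrapT => no'; apply: no; exists chi; split=> // l D lL DP HlD.
  by apply: no'; exists l, D.
pose Ym := Y `&` [set i | m <= i].
have nYm : ~ small M Ym.
  move=> sYm; apply: nM; apply: small_sub (small_setU sYm (@small_finite M m `I_m _)) =>
    // i Yi.
  by case: (ltnP i m); [right|left].
(* Some color class of [S] is not small. Its color is below [u.*2], since for the other colors the
   failure of [H] makes the class avoid a member of [M]. *)
have color S be : S `<=` Ym -> ~ small M S -> exists l S', [/\ S' `<=` S, ~ small M S' &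
    l < u.*2 /\ forall D, inset D S' -> ~ bad c D /\
      ~ trig (odd l) (cpair (cpair x (nat_of_bool be.1)) (cpair y (nat_of_bool be.2))) D].
  move=> SYm nS; have [chiL chiN] := chiP be.
  have [|l lL nS'] := small_color (L := L) (chi := chi be) nS.
    by move=> i /SYm [Yi mi]; exact: chiL.
  exists l, (S `&` [set i | chi be i = l]).
  have DP D : inset D (S `&` [set i | chi be i = l]) ->
      forall i, bit D i -> [/\ Y i, m <= i & chi be i = l].
    by move=> DS i /DS [/SYm [Yi mi] /= il].
  split; [by move=> i [] | exact: nS' |].
  case: (ltnP l u.*2) => lu; last first.
    have lk : l - u.*2 < k by move: lL; rewrite /L; lia.
    case: nS'; apply: (small_avoid (BZ _ lk).1) => D /DP /(chiN _ _ lL).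
    by rewrite /H ltnNge lu.
  split=> // D /DP /(chiN _ _ lL); rewrite /H lu => nH.
  by split=> h; apply: nH; [left|right].
have diverge t z S : ~ small M S -> (forall D, inset D S -> ~ bad c D) ->
    (forall D (v : bool), inset D S -> ~ forces (d t) (cup (fin c t) D) z v) ->
    exists c' t, [/\ good c', ext c c' & sat c' (d t) t].
  move=> nS SB Sz.
  (* [S] avoids this [B] and is not small, so [B] is not in [M]. The stems stay as they are. *)
  pose B D := bad c D \/ exists v, (v <= 1) /\ forces (d t) (cup (fin c t) D) z v.
  exists (Cond (fin c) (len c) B), t; split.
  - split=> //=.
      rewrite /B; apply: sigma_or => //; apply: sigma_ex; apply: sigma_and.
        by apply: sigma_dec; comp_auto.
      have cc : computes Y (fun w => cup (fin c t) (pi1 w)) by apply: comp_cup; comp_auto.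
      by apply: (sigma_app3 (sigma_forces Y (d t))); rewrite //; comp_auto.
    move=> MB; apply: nS; apply: (small_avoid MB) => D DS [/(SB D DS)//|[v [v1 fv]]].
    by apply: (Sz D (v == 1) DS); case: v v1 fv => [|[|]].
  - split=> // Z ZB D DZ bD; apply: (ZB D); last by left.
    by move=> i /DZ [//|[t' /= []]] ->.
  - right; exists z => D v fv; right; exists v; split=> //; exact: leq_b1.
(* Any two of these three pairs of values differ in some coordinate, so that two colors on the same
   side exclude both values at [x] or both at [y]. *)
have [l1 [S1 [S1m nS1 [_ S1P]]]] := color Ym (false, false) (fun _ => id) nYm.
have [l2 [S2 [S21 nS2 [_ S2P]]]] := color S1 (false, true) S1m nS1.
have [l3 [S3 [S32 nS3 [_ S3P]]]] := color S2 (true, false) (subset_trans S21 S1m) nS2.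
have D31 D : inset D S3 -> inset D S1 by move=> DS i /DS /S32 /S21.
have D32 D : inset D S3 -> inset D S2 by move=> DS i /DS /S32.
have nbad D : inset D S3 -> ~ bad c D by move=> /S3P [].
have [e12|n12] := eqVneq (odd l1) (odd l2).
  apply: (diverge (odd l1) y S3) => // D v DS fv.
  have [_] := S1P D (D31 D DS); have [_] := S2P D (D32 D DS).
  by rewrite -e12 /trig !cpairE; case: v fv => fv n2 n1; [apply: n2|apply: n1]; right.
have [e13|n13] := eqVneq (odd l1) (odd l3).
  apply: (diverge (odd l1) x S3) => // D v DS fv.
  have [_] := S1P D (D31 D DS); have [_] := S3P D DS.
  by rewrite -e13 /trig !cpairE; case: v fv => fv n2 n1; [apply: n2|apply: n1]; left.
have e23 : odd l2 = odd l3 by case: (odd l1) (odd l2) (odd l3) n12 n13 => [] [] [].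
apply: (diverge (odd l2) x S3) => // D v DS fv.
have [_] := S2P D (D32 D DS); have [_] := S3P D DS.
by rewrite -e23 /trig !cpairE; case: v fv => fv n2 n1; [apply: n2|apply: n1]; left.
Qed.

Lemma unbounded_infinite (S : set nat) :
  (forall n, exists2 i, n <= i & S i) -> infinite_set S.
Proof.
move=> Su /finite_fsetP [X eX]; have [i] := Su (\max_(i <- enum_fset X) i).+1.
rewrite eX => + /= iX; apply/negP; rewrite -ltnNge ltnS.
exact: (@leq_bigmax_seq _ (enum_fset X) xpredT id).
Qed.

(** Stage [n] treats two programs, one per side, and satisfies one of them. As all pairs of programs
    are treated, one side succeeds against every program. *)
Lemma partition_generic :
  exists t G, [/\ infinite_set G, G `<=` A t & ~ PA_degree G].
Proof.
have [e eP] := code_enum.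
have good0 : good (Cond (fun=> 0) 0 (fun=> False)).
  split=> /= [|MF|t i]; last by rewrite bit_0.
    apply: sigma_ext (sigma_dec (dec_const Y false)) => z; split=> //.
  by apply: nM; apply: (small_avoid MF) => D _.
pose T := {c | good c}.
pose Den n (x : T) := (forall t, exists2 i, n <= i & bit (fin (sval x) t) i) /\
  exists t, sat (sval x) (e (if t then pi1 n else pi2 n)) t.
have [|s [_ sext sDen]] := @generic_sequence T
    (fun x y => ext (sval x) (sval y)) Den (exist _ _ good0).
  have keep c c' t i : good c -> ext c c' -> bit (fin c t) i -> bit (fin c' t) i.
    by move=> [_ _ cA] [_ cc' _] ci; rewrite cc' //; have [] := cA t i ci.
  move=> n [c gc]; have [c1 [gc1 cc1 [i1 ni1 ci1]]] := growth true n gc.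
  have [c2 [gc2 cc2 [i2 ni2 ci2]]] := growth false n gc1.
  have [c3 [t [gc3 cc3 st]]] := decide (fun t => e (if t then pi1 n else pi2 n)) gc2.
  exists (exist _ c3 gc3) => /=; first exact: ext_trans (ext_trans cc1 cc2) cc3.
  split; last by exists t.
  case; [exists i1 | exists i2] => //; apply: (keep _ _ _ _ gc2 cc3) => //.
  exact: (keep _ _ _ _ gc1 cc2).
pose c n := sval (s n); have gc n : good (c n) by exact: svalP (s n).
have cext n m : n <= m -> ext (c n) (c m).
  elim: m => [|m IHm]; first by rewrite leqn0 => /eqP ->; exact: ext_refl.
  rewrite leq_eqVlt => /orP[/eqP ->|/IHm nm]; first exact: ext_refl.
  exact: ext_trans nm (sext m).
pose G t := [set i | exists n, bit (fin (c n) t) i].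
have GE t n i : i < len (c n) -> (i \in G t) = bit (fin (c n) t) i.
  move=> il; apply/idP/idP => [/set_mem [m mi]|ni]; last by apply/mem_set; exists n.
  have [_ _ cA] := gc m; have [_ im] := cA t i mi.
  case: (leqP n m) => [/cext|/ltnW /cext] [_ E _]; first by rewrite -E.
  by rewrite E.
have lenP n : n < len (c n.+1).
  have [/(_ true) [i ni ci] _] := sDen n; have [_ _ cA] := gc n.+1.
  by have [_ il] := cA true i ci; exact: leq_ltn_trans il.
have [t tP] : exists t, forall d, exists n, sat (c n) d t.
  apply: contrapT => no.
  have nosat t : exists d, forall n, ~ sat (c n) d t.
    apply: contrapT => no'; apply: no; exists t => d; apply: contrapT => no''.
    by apply: no'; exists d => n sn; apply: no''; exists n.
  have [d1 d1P] := nosat true; have [d2 d2P] := nosat false.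
  have [n1 n1e] := eP d1; have [n2 n2e] := eP d2.
  have [_ [t]] := sDen (cpair n1 n2); rewrite !cpairE.
  by case: t; rewrite ?n1e ?n2e; [exact: d1P | exact: d2P].
exists t, (G t); split.
- apply: unbounded_infinite => n; have [/(_ t) [i ni ci] _] := sDen n.
  by exists i => //; exists n.+1.
- by move=> i [n ni]; have [_ _ cA] := gc n; have [] := cA t i ni.
apply: nonPA_of => d; have [n] := tP d.
case=> [[x [b [xb ev]]]|[x noD]]; [left|right].
  by exists x, b; split=> //; apply: ev => i; exact: GE.
exists x => b /eval_forces [l0 fl0].
pose m := (n + l0).+1; have nm : n <= m by rewrite /m; lia.
have [D DP] : exists D, bit D =1 fun i => bit (fin (c m) t) i && ~~ bit (fin (c n) t) i.
  by apply: (@code_exists _ (fin (c m) t)) => i /andP[/bit_ltn].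
have [_ cnm Bnm] := cext n m nm.
have eD : cup (fin (c n) t) D = fin (c m) t.
  apply: bit_inj => i; rewrite bit_cup DP; case: (boolP (bit (fin (c n) t) i)) => ni /=.
    by rewrite cnm //; have [_ _ cA] := gc n; have [] := cA t i ni.
  by rewrite andbT.
have ff : forces d (fin (c m) t) x b.
  apply: fl0 => i il; apply: GE; apply: leq_trans (lenP _).
  by move: il; lia.
have [sBm nBm _] := gc m.
(* The empty reservoir is admissible by [large0], so the part [D] added after stage [n] avoids
   [bad (c n)], against [noD]. *)
apply: (Bnm set0 _ D _); last by apply: noD; rewrite eD; exact: ff.
  move=> D' D'0; suff -> : D' = 0 by exact: large0.
  by apply: bit_inj => i; rewrite bit_0; apply/negP => /D'0.
by move=> i; rewrite DP => /andP[mi ni]; right; exists t.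
Qed.

End Partition.

(** * Partition regularity of the sets with an infinite subset of non-PA degree *)

Definition tame (S : set nat) :=
  exists Z, [/\ infinite_set Z, Z `<=` S & ~ PA_degree Z].

Lemma tame_sub S S' : S `<=` S' -> tame S -> tame S'.
Proof.
by move=> SS' [Z [? ZS ?]]; exists Z; split=> //; exact: subset_trans SS'.
Qed.

Lemma tame_setU S S' : tame (S `|` S') -> tame S \/ tame S'.
Proof.
move=> [Y [Yinf YSS' nPA]].
have [M [Ms nM Mmax]] := exists_maximal Yinf.
have small0 : small M set0 by apply: (@small_finite _ 0).
have smallU : ~ (small M (Y `&` S) /\ small M (Y `\` S)).
  move=> [s1 s2]; apply: nM; apply: small_sub (small_setU s1 s2) => i Yi.
  by have [Si|nSi] := pselect (S i); [left|right].
suff [t [G [Ginf GA GnPA]]] : exists (t : bool) G, [/\ infinite_set G,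
    G `<=` (if t then Y `&` S else Y `\` S) & ~ PA_degree G].
  case: t GA => GA; [left|right]; exists G; split=> // i /GA [Yi] //.
  by case: (YSS' _ Yi).
have gen (A : bool -> set nat) := @partition_generic Y M A nPA Ms nM Mmax.
(* A small side is discarded: both generic sets are then sought in the other side, which covers [Y]
   up to a small set. *)
have [s1|n1] := pselect (small M (Y `&` S)).
  have n2 : ~ small M (Y `\` S) by move=> s2; apply: smallU.
  have [||t [G GP]] := gen (fun=> Y `\` S) (fun=> n2).
  - by move=> _ i [].
  - apply: small_sub s1 => i [Yi nU]; split=> //; apply: contrapT => nSi.
    by apply: nU; left.
  by exists false, G.
have [s2|n2] := pselect (small M (Y `\` S)).
  have [||t [G GP]] := gen (fun=> Y `&` S) (fun=> n1).
  - by move=> _ i [].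
  - apply: small_sub s2 => i [Yi nU]; split=> // Si.
    by apply: nU; left.
  by exists true, G.
apply: (gen (fun t => if t then Y `&` S else Y `\` S)); first by case.
  by case=> i [].
apply: small_sub small0 => i [Yi []].
by have [Si|nSi] := pselect (S i); [left|right].
Qed.

(** * Sparse families of finite sets *)

Lemma card_bit_wide n w : w <= n -> \sum_(i < n) bit w i = card_bit w.
Proof.
move=> wn; rewrite /card_bit -(subnKC wn) big_split_ord /= [X in _ + X]big1 ?addn0 //.
by move=> i _; apply/eqP; rewrite eqb0; apply/negP => /bit_ltn; lia.
Qed.

Lemma sum_eq_op n u : \sum_(i < n) ((i : nat) == u) <= 1.
Proof.
elim: n => [|n IHn]; first by rewrite big_ord0.
rewrite big_ord_recr /=; case: eqP => [<-|_]; last by rewrite addn0.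
rewrite big1 // => i _; apply/eqP; rewrite eqb0; have := ltn_ord i; lia.
Qed.

Lemma card_adjoin w i : card_bit (adjoin w i) = card_bit w + ~~ bit w i.
Proof.
pose n := w + adjoin w i + i.+1.
rewrite -(@card_bit_wide n (adjoin w i)) ?/n; last by lia.
rewrite -(@card_bit_wide n w) ?/n; last by lia.
case: (boolP (bit w i)) => wi /=.
  by rewrite addn0; apply: eq_bigr => j _; rewrite bit_adjoin; case: eqP => [->|];
    rewrite ?wi ?orbF.
have iN : i < n by rewrite /n; lia.
rewrite (bigD1 (Ordinal iN)) // [in RHS](bigD1 (Ordinal iN)) //= bit_adjoin eqxx orbT
  (negbTE wi).
rewrite add0n addnC; congr (_ + _); apply: eq_bigr => j jN.
rewrite bit_adjoin (_ : (j : nat) == i = false) ?orbF //; apply/negbTE.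
by apply: contra jN => /eqP ji; apply/eqP/val_inj.
Qed.

Lemma card_adjoin_leq w i : card_bit (adjoin w i) <= (card_bit w).+1.
Proof. by rewrite card_adjoin; case: (bit w i) => /=; lia. Qed.

Lemma adjoinC w i j : adjoin (adjoin w i) j = adjoin (adjoin w j) i.
Proof. by apply: bit_inj => k; rewrite !bit_adjoin -!orbA [_ || (k == j)]orbC. Qed.

Lemma infinite_code (S : set nat) n : infinite_set S ->
  exists2 w, inset w S & card_bit w = n.
Proof.
move=> Sinf; elim: n => [|n [w wS wn]].
  by exists 0; [move=> i; rewrite bit_0 | rewrite /card_bit big_ord0].
have [i wi Si] := infinite_ge w Sinf; exists (adjoin w i).
  by move=> j; rewrite bit_adjoin => /orP[/wS|/eqP ->].
by rewrite card_adjoin wn; case: (boolP (bit w i)) => [/bit_ltn|]; [lia | rewrite addn1].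
Qed.

Definition edges (N : nat -> bool) D A Z :=
  \sum_(a < A) \sum_(z < Z) [&& bit A a, bit Z z & N (adjoin (adjoin D a) z)].

(** Two base sets are allowed because [sparse_limit] compares [D] with [adjoin D y]. *)
Lemma leq_edges (N N' N'' : nat -> bool) D D' A Z :
    (forall a z, bit A a -> bit Z z -> N (adjoin (adjoin D a) z) ->
       N' (adjoin (adjoin D a) z) || N'' (adjoin (adjoin D' a) z)) ->
  edges N D A Z <= edges N' D A Z + edges N'' D' A Z.
Proof.
move=> NN; rewrite /edges -big_split /=; apply: leq_sum => a _.
rewrite -big_split /=; apply: leq_sum => z _.
case: (boolP (bit A a)) => //= Aa; case: (boolP (bit Z z)) => //= Zz.
have := NN a z Aa Zz; case: (N _) => //= /(_ isT).
by case: (N' _); case: (N'' _).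
Qed.

Lemma edges_full (N : nat -> bool) D A Z :
    (forall a z, bit A a -> bit Z z -> N (adjoin (adjoin D a) z)) ->
  edges N D A Z = card_bit A * card_bit Z.
Proof.
move=> NN; rewrite /edges /card_bit big_distrlr /=.
apply: eq_bigr => a _; apply: eq_bigr => z _.
case: (boolP (bit A a)) => //= Aa; case: (boolP (bit Z z)) => //= Zz.
by rewrite NN.
Qed.

(** Among the one-point extensions of [D] in [P], few pairs are incompatible.
    This is a closed condition on [P], stable under intersections and limits. *)
Definition sparse C (P : set nat) := forall D A Z,
  (forall a, bit A a -> P (adjoin D a)) -> (forall z, bit Z z -> P (adjoin D z)) ->
  edges (fun E => E \notin P) D A Z <=
    C * 2 ^ card_bit D * (card_bit A + card_bit Z).

Lemma sparseI C C' P P' :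
  sparse C P -> sparse C' P' -> sparse (C + C') (P `&` P').
Proof.
move=> sP sP' D A Z AP ZP.
have e1 := sP D A Z (fun i h => (AP i h).1) (fun i h => (ZP i h).1).
have e2 := sP' D A Z (fun i h => (AP i h).2) (fun i h => (ZP i h).2).
rewrite !mulnDl; apply: leq_trans (leq_add e1 e2).
apply: leq_edges => a z _ _; rewrite -negb_and; apply: contra => /andP[/set_mem ? /set_mem ?].
exact/mem_set.
Qed.

Definition limit (U : set (set nat)) (P : set nat) : set nat :=
  [set E | P E /\ U [set y | P (adjoin E y)]].

(** For a suitable [y], a pair incompatible for the limit is incompatible for [P] over [D] or over
    [adjoin D y]. The exponential weight in [sparse] makes the larger base cost only a factor 2. *)
Lemma sparse_limit (U : set (set nat)) C P :
  UltraFilter U -> sparse C P -> sparse (3 * C) (limit U P).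
Proof.
move=> UU sP D A Z AP ZP.
have UA : U [set y | forall a, a < A -> bit A a -> P (adjoin (adjoin D a) y)].
  apply: (@filter_finite _ (fun a => [set y | bit A a -> P (adjoin (adjoin D a) y)])) => a _.
  case: (boolP (bit A a)) => [/AP [_ Ua]|_]; first by apply: (filterS _ Ua) => y /=.
  by apply: filterS filterT => y _ /=.
have UZ : U [set y | forall a, a < Z -> bit Z a -> P (adjoin (adjoin D a) y)].
  apply: (@filter_finite _ (fun a => [set y | bit Z a -> P (adjoin (adjoin D a) y)])) => a _.
  case: (boolP (bit Z a)) => [/ZP [_ Ua]|_]; first by apply: (filterS _ Ua) => y /=.
  by apply: filterS filterT => y _ /=.
have UN : U [set y | forall a, a < A -> forall z, z < Z ->
    P (adjoin (adjoin (adjoin D a) z) y) -> U [set y | P (adjoin (adjoin (adjoin D a) z) y)]].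
  apply: (@filter_finite _ (fun a => [set y | forall z, z < Z ->
    P (adjoin (adjoin (adjoin D a) z) y) ->
      U [set y | P (adjoin (adjoin (adjoin D a) z) y)]])) => a _.
  apply: (@filter_finite _ (fun z => [set y |
    P (adjoin (adjoin (adjoin D a) z) y) ->
      U [set y | P (adjoin (adjoin (adjoin D a) z) y)]])) => z _.
  have [h|h] := in_ultra_setVsetC [set y | P (adjoin (adjoin (adjoin D a) z) y)] UU.
    by apply: filterS filterT => y _ /=.
  by apply: filterS h => y /=.
have [y [[yA yZ] yN]] := filter_ex (filterI (filterI UA UZ) UN).
have e1 := sP D A Z (fun i h => (AP i h).1) (fun i h => (ZP i h).1).
have e2 : edges (fun E => E \notin P) (adjoin D y) A Z <=
    C * 2 ^ card_bit (adjoin D y) * (card_bit A + card_bit Z).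
  apply: sP => i Ai; rewrite adjoinC; first by apply: yA => //; exact: bit_ltn.
  by apply: yZ => //; exact: bit_ltn.
apply: leq_trans (leq_trans (leq_edges _) (leq_add e1 e2)) _.
  move=> a z Aa Zz; rewrite -negb_and; apply: contra => /andP[/set_mem PE].
  rewrite [adjoin (adjoin D y) a]adjoinC adjoinC => /set_mem PEy.
  by apply/mem_set; split=> //; apply: yN => //; apply: bit_ltn.
(* The base [D] contributes the weight once and [adjoin D y] at most twice, which gives the factor
   3. *)
rewrite -mulnDl leq_mul2r; apply/orP; right.
have : 2 ^ card_bit (adjoin D y) <= 2 ^ (card_bit D).+1.
  by rewrite leq_exp2l // card_adjoin_leq.
by rewrite expnS; nia.
Qed.

(** [U]-many [y] are incompatible with all exceptions at once. As many of them as there are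
    exceptions yield a complete bipartite graph, whose quadratic number of edges contradicts the
    linear bound unless [Z] is small. *)
Lemma few_exceptions (U : set (set nat)) C P F (Y : set nat) Z :
    UltraFilter U -> (forall S, U S -> infinite_set S) -> sparse C P -> U Y ->
    (forall y, Y y -> P (adjoin F y)) -> inset Z Y ->
    (forall z, bit Z z -> ~ limit U P (adjoin F z)) ->
  card_bit Z <= 2 * (C * 2 ^ card_bit F).
Proof.
move=> UU Uinf sP UY YP ZY Zex.
have UZ : U [set y | forall z, z < Z -> bit Z z -> ~ P (adjoin (adjoin F z) y)].
  apply: (@filter_finite _ (fun z => [set y | bit Z z -> ~ P (adjoin (adjoin F z) y)])) => z _.
  have [h|h] := in_ultra_setVsetC [set y | P (adjoin (adjoin F z) y)] UU; last first.
    by apply: filterS h => y /=.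
  apply: filterS filterT => y _ /= Zz; case: (Zex z Zz); split=> //.
  exact/YP/ZY.
have [A AS cA] := infinite_code (card_bit Z) (Uinf _ (filterI UY UZ)).
have := sP F Z A; rewrite edges_full.
  move=> /(_ _ _)/(leq_trans _); rewrite cA.
  have [->//|Z0] := posnP (card_bit Z).
  move=> /(_ (card_bit Z * card_bit Z)) h.
  have : card_bit Z * card_bit Z <= C * 2 ^ card_bit F * (card_bit Z + card_bit Z).
    by apply: h => // [z /ZY /YP|z /AS [/YP]].
  by rewrite addnn -mul2n mulnA leq_pmul2r // mulnC.
move=> z a Zz /AS [_ /(_ z (bit_ltn Zz) Zz)] nP.
by apply/negP => /set_mem.
Qed.

(** * Rainbows of a 2-bounded coloring *)

Section Rainbow.
Variable f : upair -> nat.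
Hypothesis hf : two_bounded f.

Definition rainbows : set nat := [set E | rainbow f [set i | bit E i]].

Lemma two_bounded_eq p q r : f p = f q -> f p = f r -> [\/ p = q, p = r | q = r].
Proof.
move=> pq pr; have /pcard_leP [g] := hf (f p).
have gI s : f s = f p -> g s < 2 by move=> sp; apply: (@funS _ _ _ _ g).
have ginj s t : f s = f p -> f t = f p -> g s = g t -> s = t.
  by move=> sp tp; apply: (@inj _ _ _ g); rewrite inE.
have [gp gq gr] := And3 (gI p erefl) (gI q (esym pq)) (gI r (esym pr)).
have [e|n1] := eqVneq (g p) (g q); first by constructor 1; apply: ginj.
have [e|n2] := eqVneq (g p) (g r); first by constructor 2; apply: ginj.
constructor 3; apply: ginj => //.
by move: gp gq gr n1 n2; lia.
Qed.

(** [z] lies on the partner of the pair [{x, y}] with respect to color *)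
Definition mate (x y z : nat) : bool :=
  `[< exists p q : upair, [/\ val p = [fset x; y]%fset, p <> q, f p = f q & z \in val q] >].

Lemma upair_eq (p : upair) : exists x y, x != y /\ val p = [fset x; y]%fset.
Proof.
have /fset0Pn [x px] : val p != fset0%fset by rewrite -cardfs_gt0 (eqP (valP p)).
have := valP p; rewrite /= (cardfsD1 x) px => /eqP [/eqP /cardfs1P [y py]].
exists x, y; rewrite -py fsetD1K //; split=> //.
by have := fset11 y; rewrite -py !inE eq_sym => /andP[].
Qed.

(** The pair [{x, y}] has at most one partner of the same color, and that partner has two
    elements. *)
Lemma card_mate n x y : \sum_(z < n) mate x y z <= 2.
Proof.
have [[z0 /asboolP [p [q [pxy pq fpq zq]]]]|no] := pselect (exists z, mate x y z); last first.
  rewrite big1 // => z _; apply/eqP; rewrite eqb0; apply/negP => h; apply: no.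
  by exists z.
have [u [v [_ quv]]] := upair_eq q.
apply: (@leq_trans (\sum_(z < n) (((z : nat) == u) + ((z : nat) == v)))).
  apply: leq_sum => z _; case: (boolP (mate x y z)) => //.
  move=> /asboolP [p' [q' [p'xy pq' fpq' zq']]].
  have ep : p' = p by apply: val_inj; rewrite pxy.
  subst p'; case: (two_bounded_eq fpq fpq') => // eq; subst q'.
  by move: zq'; rewrite quv !inE => /orP[/eqP ->|/eqP ->]; rewrite eqxx ?addn1.
by rewrite big_split /= -[2]/(1 + 1) leq_add // sum_eq_op.
Qed.

Definition hit E z := has (fun x => has (fun y =>
  [&& bit E x, bit E y & mate x y z]) (iota 0 E)) (iota 0 E).

Lemma card_hit n E : \sum_(z < n) hit E z <= 2 * card_bit E ^ 2.
Proof.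
apply: (@leq_trans (\sum_(z < n) \sum_(x < E) \sum_(y < E)
    [&& bit E x, bit E y & mate x y z])).
  apply: leq_sum => z _; case: (boolP (hit E z)) => // /hasnP [x xE /hasnP [y yE h]].
  have term (F : nat -> nat) i : i < E -> F i <= \sum_(j < E) F j.
    by move=> iE; rewrite (bigD1 (Ordinal iE)) //= leq_addr.
  apply: leq_trans (term (fun x => \sum_(y < E) [&& bit E x, bit E y & mate x y z]) x xE).
  apply: leq_trans (term (fun y => nat_of_bool [&& bit E x, bit E y & mate x y z]) y yE).
  by rewrite h.
rewrite exchange_big /=.
apply: (@leq_trans (\sum_(x < E) \sum_(y < E) bit E x * bit E y * 2)).
  apply: leq_sum => x _; rewrite exchange_big /=; apply: leq_sum => y _.
  case: (bit E x); last by rewrite big1.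
  case: (bit E y); last by rewrite big1.
  exact: card_mate.
rewrite mulnC /card_bit -mulnn big_distrlr /= big_distrl /=; apply: leq_sum => x _.
by rewrite big_distrl.
Qed.

(** Two pairs of equal color cannot both omit [z] or both omit [a], nor both contain [a] and [z]. So
    one of the two points lies in exactly one of the pairs and is hit by the other. *)
Lemma conflict_hit D a z :
    rainbows (adjoin D a) -> rainbows (adjoin D z) ->
    adjoin (adjoin D a) z \notin rainbows ->
  hit (adjoin D a) z || hit (adjoin D z) a.
Proof.
move=> Da Dz /negP nR.
have hitP E p q x : upairs [set i | bit E i] p -> p <> q -> f p = f q ->
    x \in val q -> hit E x.
  move=> pE pq fpq xq; have [u [v [_ puv]]] := upair_eq p.
  have [uE vE] : bit E u /\ bit E v by split; apply: pE; rewrite puv !inE eqxx ?orbT.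
  apply/hasnP; exists u; first exact: bit_ltn.
  apply/hasnP; exists v; first exact: bit_ltn.
  by rewrite uE vE /=; apply/asboolP; exists p, q.
suff [p [q [pE qE fpq pq]]] : exists p q, [/\ upairs [set i | bit (adjoin (adjoin D a) z) i] p,
    upairs [set i | bit (adjoin (adjoin D a) z) i] q, f p = f q & p <> q].
  have avoid w w' r : upairs [set i | bit (adjoin (adjoin D w) w') i] r ->
      w' \notin val r -> upairs [set i | bit (adjoin D w) i] r.
    move=> rE w'r x xr; have := rE x xr; rewrite /= bit_adjoin => /orP[//|/eqP e].
    by move: w'r; rewrite -e xr.
  have Daz : adjoin (adjoin D a) z = adjoin (adjoin D z) a by exact: adjoinC.
  have fqp := esym fpq; have qp : q <> p by move=> /esym.
  case: (boolP (z \in val p)) => zp; last first.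
    case: (boolP (z \in val q)) => zq; first by rewrite (hitP _ p q) //; exact: avoid pE zp.
    by case: pq; apply: Da => //; rewrite inE; [exact: avoid pE zp | exact: avoid qE zq].
  case: (boolP (z \in val q)) => zq; last first.
    by rewrite (hitP _ q p) //; exact: avoid qE zq.
  rewrite Daz in pE qE.
  case: (boolP (a \in val p)) => ap; last first.
    case: (boolP (a \in val q)) => aq.
      by rewrite (hitP (adjoin D z) p q a) ?orbT //; exact: avoid pE ap.
    by case: pq; apply: Dz => //; rewrite inE; [exact: avoid pE ap | exact: avoid qE aq].
  case: (boolP (a \in val q)) => aq; last first.
    by rewrite (hitP (adjoin D z) q p a) ?orbT //; exact: avoid qE aq.
  (* If [a = z], the set is already [adjoin D a]; otherwise both pairs are [{a, z}]. *)
  have [az|naz] := eqVneq a z.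
    subst a; case: pq; apply: Da; rewrite // inE => x xr; [have := pE x xr|have := qE x xr];
      by rewrite /= !bit_adjoin -orbA orbb.
  case: pq; apply: val_inj.
  have two (r : upair) : a \in val r -> z \in val r -> val r = [fset a; z]%fset.
    move=> ar zr; apply/esym/eqP; rewrite eqEfcard cardfs2 naz (eqP (valP r)) leqnn andbT.
    by apply/fsubsetP => x; rewrite !inE => /orP[/eqP ->|/eqP ->].
  by rewrite (two p ap zp) (two q aq zq).
apply: contrapT => no; apply: nR; apply/mem_set => p q.
rewrite !inE => pE qE fpq; apply: contrapT => pq; apply: no.
by exists p, q.
Qed.

(** Turns the quadratic count of [card_hit] into the exponential one of [sparse]; with the factor 2
    there, it yields the constant 8. *)
Lemma leq_sqr_exp2 n : n.+1 ^ 2 <= 4 * 2 ^ n.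
Proof.
case: n => [|[|[|n]]] //; elim: n => // n IHn.
have h : n.+4.+1 ^ 2 <= 2 * n.+4 ^ 2 by rewrite -!mulnn; nia.
by apply: leq_trans h _; rewrite [2 ^ n.+4]expnS mulnCA leq_mul2l IHn orbT.
Qed.

(** An incompatible pair is charged to [a] if [adjoin D a] hits [z], and to [z] otherwise; each
    point is charged at most [m] times. *)
Lemma sparse_rainbows : sparse 8 rainbows.
Proof.
move=> D A Z AP ZP.
pose m := 2 * (card_bit D).+1 ^ 2.
have hitm n a : \sum_(z < n) hit (adjoin D a) z <= m.
  apply: leq_trans (card_hit _ _) _; rewrite leq_mul2l /= leq_exp2r //.
  exact: card_adjoin_leq.
apply: (@leq_trans (card_bit A * m + card_bit Z * m)); last first.
  have h := leq_sqr_exp2 (card_bit D).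
  by rewrite -mulnDl mulnC leq_mul2r /m; apply/orP; right; lia.
apply: (@leq_trans (\sum_(a < A) \sum_(z < Z) bit A a * hit (adjoin D a) z +
    \sum_(a < A) \sum_(z < Z) bit Z z * hit (adjoin D z) a)).
  rewrite -big_split /=; apply: leq_sum => a _; rewrite -big_split /=.
  apply: leq_sum => z _; case: (boolP (bit A a)) => //= Aa; case: (boolP (bit Z z)) => //= Zz.
  case: (boolP (_ \notin _)) => //= /(conflict_hit (AP a Aa) (ZP z Zz)).
  by case: hit => //= ->; rewrite ?addn1.
apply: leq_add; last rewrite exchange_big /=; rewrite /card_bit big_distrl /=;
  apply: leq_sum => a _; rewrite -big_distrr /=.
  by rewrite leq_mul2l hitm orbT.
by rewrite leq_mul2l hitm orbT.
Qed.

End Rainbow.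

(** * The forcing construction *)

Definition grows (Y : set nat) F E :=
  sub_bit F E && all (fun i => bit E i ==> bit F i || (i \in Y)) (iota 0 E).

Lemma growsP (Y : set nat) F E :
  reflect ((forall i, bit F i -> bit E i) /\ (forall i, bit E i -> bit F i \/ Y i))
    (grows Y F E).
Proof.
apply: (iffP andP) => [[/sub_bitP FE /allnP EY]|[FE EY]]; split=> //.
- move=> i Ei; have := EY i (bit_ltn Ei); rewrite Ei => /orP[|/set_mem]; by [left|right].
- exact/sub_bitP.
- by apply/allnP => i _; apply/implyP => /EY [->|/mem_set ->]; rewrite ?orbT.
Qed.

Lemma comp_edges X fb fD fA fZ :
    computes X fb -> computes X fD -> computes X fA -> computes X fZ ->
  computes X (fun z => edges (bit (fb z)) (fD z) (fA z) (fZ z)).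
Proof.
move=> cb cD cA cZ.
apply: (@comp_sum X (fun w a => \sum_(z < fZ w) nat_of_bool
  [&& bit (fA w) a, bit (fZ w) z & bit (fb w) (adjoin (adjoin (fD w) a) z)])) => //.
apply: (@comp_sum X (fun w z => nat_of_bool [&& bit (fA (pi1 w)) (pi2 w),
  bit (fZ (pi1 w)) z & bit (fb (pi1 w)) (adjoin (adjoin (fD (pi1 w)) (pi2 w)) z)]));
  by comp_auto.
Qed.

(** The families [Q] of the hypothesis form a compact class. *)
Lemma sigma_question Y F C K d : sigma2 Y (fun x b => forall Q : set nat,
    Q F -> sparse C Q ->
    (forall Z, inset Z Y -> K < card_bit Z -> exists2 z, bit Z z & Q (adjoin F z)) ->
  exists E, [/\ Q E, grows Y F E & forces d E x b]).
Proof.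
rewrite /sigma2.
pose big b D A Z := C * 2 ^ card_bit D * (card_bit A + card_bit Z) < edges (bit b) D A Z.
pose ok1 A D a := all (fun i => bit A i ==> bit a (adjoin D i)) (iota 0 A).
pose ok2 Z b := all (fun z => bit Z z ==> (z \in Y) && bit b (adjoin F z)) (iota 0 Z).
(* The first three disjuncts refute the hypotheses on [Q] from finite information, positive in [a]
   and negative in [b]; the last one provides [E]. *)
pose R w a b := bit b F \/
  (exists D A Z, [&& ok1 A D a, ok1 Z D a & big b D A Z]) \/
  (exists Z, ok2 Z b && (K < card_bit Z)) \/
  (exists E, (bit a E && grows Y F E) /\ forces d E (pi1 w) (pi2 w)).
suff /sigma_compact : sigma3 Y R.
  apply: sigma_ext => w; split=> [RP Q QF Qs QZ|HP Q].
    have [a [b [aQ bQ]]] := RP Q; case=> [/bQ //|[]].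
      move=> [D [A [Z /and3P[/allnP aA /allnP aZ]]]]; rewrite /big ltnNge => /negP [].
      apply: leq_trans (Qs D A Z _ _).
      - apply: leq_sum => i _; apply: leq_sum => j _.
        case: (boolP (bit b _)) => [bE|_]; last by rewrite !andbF.
        by rewrite (_ : _ \notin Q) //; apply/negP => /set_mem; exact: bQ bE.
      - by move=> i Ai; have := aA i (bit_ltn Ai); rewrite Ai => /aQ.
      - by move=> i Zi; have := aZ i (bit_ltn Zi); rewrite Zi => /aQ.
    case=> [[Z /andP[/allnP ZY KZ]]|[E [/andP[/aQ QE FE] fE]]]; last by exists E.
    have [|z Zz Qz] := QZ Z _ KZ.
      by move=> i Zi; have := ZY i (bit_ltn Zi); rewrite Zi => /andP[/set_mem].
    by have := ZY z (bit_ltn Zz); rewrite Zz => /andP[_ /bQ].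
  (* Initial segments of [Q] and of its complement serve as [a] and [b]; [N] only has to exceed the
     codes involved. *)
  pose a N := code_of N (fun i => i \in Q); pose b N := code_of N (fun i => i \notin Q).
  suff [N RN] : exists N, R w (a N) (b N).
    exists (a N), (b N); split=> // i; rewrite bit_code_of => /andP[_]; first exact: set_mem.
    by move=> /negP nQi /mem_set.
  have [QF|nQF] := pselect (Q F); last first.
    exists F.+1; left; rewrite bit_code_of ltnSn; apply/negP => /set_mem //.
  have [Qs|/existsNP [D /existsNP [A /existsNP [Z]]]] := pselect (sparse C Q); last first.
    move=> /not_implyP [AQ /not_implyP [ZQ /negP]]; rewrite -ltnNge => bigE.
    pose m (S : nat) := \max_(i < S) adjoin D i.
    pose m2 := \max_(i < A) \max_(j < Z) adjoin (adjoin D i) j.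
    have mP (S i : nat) : i < S -> adjoin D i <= m S.
      by move=> iS; exact: (leq_bigmax (F := fun i : 'I_S => adjoin D i) (Ordinal iS)).
    have m2P (i : 'I_A) (j : 'I_Z) : adjoin (adjoin D i) j <= m2.
      apply: leq_trans (leq_bigmax (F := fun i : 'I_A => \max_(j < Z) adjoin (adjoin D i) j) i).
      exact: (leq_bigmax (F := fun j : 'I_Z => adjoin (adjoin D i) j) j).
    exists (m A + m Z + m2).+1; right; left; exists D, A, Z; apply/and3P; split.
    - apply/allnP => i iA; apply/implyP => Ai; rewrite bit_code_of (mem_set (AQ i Ai)) andbT.
      by have := mP A i iA; lia.
    - apply/allnP => i iZ; apply/implyP => Zi; rewrite bit_code_of (mem_set (ZQ i Zi)) andbT.
      by have := mP Z i iZ; lia.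
    rewrite /big (leq_trans bigE) //; apply: leq_sum => i _; apply: leq_sum => j _.
    by rewrite bit_code_of (_ : _ < _) //; have := m2P i j; lia.
  have [QZ|/existsNP [Z]] := pselect (forall Z, inset Z Y -> K < card_bit Z ->
      exists2 z, bit Z z & Q (adjoin F z)); last first.
    move=> /not_implyP [ZY /not_implyP [KZ noz]].
    exists (\max_(i < Z) adjoin F i).+1; right; right; left; exists Z; rewrite KZ andbT.
    apply/allnP => z zZ; apply/implyP => Zz; rewrite (mem_set (ZY _ Zz)) bit_code_of ltnS.
    rewrite (leq_bigmax (F := fun z : 'I_Z => adjoin F z) (Ordinal zZ)) /=; apply/negP =>
      /set_mem Qz.
    by apply: noz; exists z.
  have [E [QE FE fE]] := HP Q QF Qs QZ.
  exists E.+1; do 3 right; exists E; split=> //.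
  by rewrite bit_code_of ltnSn (mem_set QE).
rewrite /sigma3 /R; apply: sigma_or; first by apply: sigma_dec; comp_auto.
apply: sigma_or.
  do 3 apply: sigma_ex; apply: sigma_dec; rewrite /ok1 /big; comp_auto.
  by apply: comp_edges; comp_auto.
apply: sigma_or.
  by apply: sigma_ex; apply: sigma_dec; rewrite /ok2; comp_auto.
apply: sigma_ex; apply: sigma_and.
  by apply: sigma_dec; rewrite /grows /sub_bit; comp_auto.
by apply: (sigma_app3 (sigma_forces Y d)); rewrite //; comp_auto.
Qed.

(** * Conditions for building a rainbow *)

Record rcond := RCond { stem : nat; height : nat; pool : set nat; family : set nat }.

Definition rgood c := [/\ forall i, bit (stem c) i -> i < height c,
  infinite_set (pool c) /\ ~ PA_degree (pool c),
  forall i, pool c i -> height c <= i,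
  exists C, sparse C (family c) &
  family c (stem c) /\ forall y, pool c y -> family c (adjoin (stem c) y)].

Definition rext c c' := [/\ height c <= height c',
  forall i, i < height c -> bit (stem c') i = bit (stem c) i,
  forall i, bit (stem c') i -> bit (stem c) i \/ pool c i,
  pool c' `<=` pool c & family c' `<=` family c].

Lemma rext_refl c : rext c c.
Proof. by split=> // i; left. Qed.

Lemma rext_trans c1 c2 c3 : rext c1 c2 -> rext c2 c3 -> rext c1 c3.
Proof.
move=> [l12 s12 g12 p12 f12] [l23 s23 g23 p23 f23]; split.
- exact: leq_trans l23.
- by move=> i il; rewrite s23 ?s12 //; exact: leq_trans l12.
- by move=> i /g23 [/g12//|/p12]; right.
- exact: subset_trans p12.
- exact: subset_trans f12.
Qed.

(** Liu's theorem, in the form [tame_setU], allows [large_ultrafilter] to be applied to the tame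
    sets. Their being infinite puts all final segments in [U]. *)
Lemma pool_ultrafilter c : rgood c -> exists U : set (set nat),
  [/\ UltraFilter U, U (pool c), U `<=` tame & forall n, U [set i | n <= i]].
Proof.
move=> [_ [Yinf nPA] _ _ _].
have tame_inf S : tame S -> infinite_set S.
  by move=> [Z [Zinf ZS _]]; apply: contra_not Zinf; exact: sub_finite_set.
have [||||U [UU UY Ut]] := @large_ultrafilter tame (pool c).
- exact: tame_sub.
- exact: tame_setU.
- by move=> /tame_inf; apply; exact: finite_set0.
- by exists (pool c); split.
exists U; split=> // n; have [//|] := in_ultra_setVsetC [set i | n <= i] UU.
move=> /Ut /tame_inf []; apply: sub_finite_set (finite_II n) => i /=.
by move=> /negP; rewrite -ltnNge.
Qed.

(** For [E] in the limit, the [y] that may be added to [E] form a set in [U], which is tame and so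
    contains a new pool. *)
Lemma rextend (U : set (set nat)) c E l : rgood c -> UltraFilter U -> U (pool c) ->
    U `<=` tame -> (forall n, U [set i | n <= i]) ->
    limit U (family c) E -> grows (pool c) (stem c) E ->
  exists c', [/\ rgood c', rext c c', stem c' = E & l <= height c'].
Proof.
move=> [sl Yg Yl [C Cs] _] UU UY Ut Un [PE UE] /growsP [FE EY].
pose l' := height c + l + E.
have [Y' [Y'inf Y'S nPA]] := Ut _ (filterI (filterI UY UE) (Un l')).
exists (RCond E l' Y' (family c)); split=> //=; last by rewrite /l'; lia.
- split=> //=.
  + by move=> i /bit_ltn; rewrite /l'; lia.
  + by move=> i /Y'S [].
  + by exists C.
  + by split=> // y /Y'S [[]].
- split=> //=; first by rewrite /l'; lia.
    move=> i il; apply/idP/idP => [/EY [//|/Yl]|/FE//].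
    by rewrite leqNgt il.
  by move=> i /Y'S [[]].
Qed.

(** The bound [K] lets [sigma_question] demand the same of every [Q] without mentioning [U]. *)
Lemma limit_exceptions (U : set (set nat)) c : rgood c -> UltraFilter U -> U (pool c) ->
    U `<=` tame -> exists K, forall Z, inset Z (pool c) -> K < card_bit Z ->
  exists2 z, bit Z z & limit U (family c) (adjoin (stem c) z).
Proof.
move=> [_ _ _ [C Cs] [_ FY]] UU UY Ut; exists (2 * (C * 2 ^ card_bit (stem c))) => Z ZY KZ.
apply: contrapT => noz; move: KZ; rewrite ltnNge => /negP; apply.
apply: (few_exceptions UU _ Cs UY FY ZY) => [S /Ut [G [Ginf GS _]]|z Zz Lz].
  by apply: contra_not Ginf; exact: sub_finite_set.
by apply: noz; exists z.
Qed.

Lemma rgrowth c n : rgood c ->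
  exists c', [/\ rgood c', rext c c', n <= height c' & exists2 i, n <= i & bit (stem c') i].
Proof.
move=> gc; have [U [UU UY Ut Un]] := pool_ultrafilter gc.
have [K KP] := limit_exceptions gc UU UY Ut.
have [Z ZS cZ] : exists2 Z, inset Z (pool c `&` [set i | n <= i]) & card_bit Z = K.+1.
  apply: infinite_code; have [G [Ginf GS _]] := Ut _ (filterI UY (Un n)).
  by apply: contra_not Ginf; exact: sub_finite_set.
have [||z Zz Lz] := KP Z; first by move=> i /ZS [].
  by rewrite cZ.
have [Yz nz] := ZS z Zz.
have [|c' [gc' cc' sc' nc']] := rextend n gc UU UY Ut Un Lz.
  apply/growsP; split=> i; rewrite bit_adjoin; first by move->.
  by move=> /orP[|/eqP ->]; [left|right].
exists c'; split=> //; exists z => //.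
by rewrite sc' bit_adjoin eqxx orbT.
Qed.

Definition rsat c d :=
  (exists x (b : bool), phi x x b /\ forall X : set nat,
     (forall i, i < height c -> (i \in X) = bit (stem c) i) -> eval X d x b) \/
  (exists x, forall E (b : bool),
     family c E -> grows (pool c) (stem c) E -> ~ forces d E x b).

Lemma rdecide c d : rgood c -> exists c', [/\ rgood c', rext c c' & rsat c' d].
Proof.
move=> gc; have [U [UU UY Ut Un]] := pool_ultrafilter gc.
have [K KP] := limit_exceptions gc UU UY Ut.
have [sl [Yinf nPA] Yl [C Cs] [PF FY]] := gc.
have sV := sigma_question (pool c) (stem c) (3 * C) K d.
have [exV|/existsNP [x nx]] := pselect (forall x, exists b : bool,
    forall Q : set nat, Q (stem c) -> sparse (3 * C) Q ->
    (forall Z, inset Z (pool c) -> K < card_bit Z ->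
      exists2 z, bit Z z & Q (adjoin (stem c) z)) ->
    exists E, [/\ Q E, grows (pool c) (stem c) E & forces d E x b]).
  have [x [b [xb Vx]]] := nonPA_diagonal nPA sV exV.
  (* The limit is an admissible [Q]: [sparse_limit] accounts for the constant [3 * C], and [KP] is
     the last hypothesis. *)
  have [|||E [LE FE [l fl]]] := Vx (limit U (family c)) => //.
  - by split=> //; apply: filterS UY.
  - exact: sparse_limit.
  have [c' [gc' cc' sc' lc']] := rextend l gc UU UY Ut Un LE FE.
  exists c'; split=> //; left; exists x, b; split=> // X XE; apply: fl => i il.
  by rewrite XE ?sc' //; exact: leq_trans lc'.
have /choice [Q QP] : forall b : bool, exists Q : set nat, [/\ Q (stem c), sparse (3 * C) Q,
    (forall Z, inset Z (pool c) -> K < card_bit Z ->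
      exists2 z, bit Z z & Q (adjoin (stem c) z)) &
    forall E, Q E -> grows (pool c) (stem c) E -> ~ forces d E x b].
  move=> b; apply: contrapT => noQ; apply: nx; exists b => Q QF Qs QZ.
  apply: contrapT => noE; apply: noQ; exists Q; split=> // E QE FE fE.
  by apply: noE; exists E.
(* Otherwise the pool would have infinitely many [z], hence [K.+1] of them, with [adjoin (stem c) z]
   outside [Q b]. *)
have UQ b : U [set y | Q b (adjoin (stem c) y)].
  have [//|UC] := in_ultra_setVsetC [set y | Q b (adjoin (stem c) y)] UU.
  have [G [Ginf GS _]] := Ut _ (filterI UY UC).
  have [Z ZG cZ] := infinite_code K.+1 Ginf.
  have [_ _ QZ _] := QP b; have [||z Zz Qz] := QZ Z.
  - by move=> i /ZG /GS [].
  - by rewrite cZ.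
  by have [_] := GS z (ZG z Zz).
have [Y' [Y'inf Y'S nPA']] := Ut _ (filterI UY (filterI (UQ true) (UQ false))).
have [Qt st _ nt] := QP true; have [Qf sf _ nf] := QP false.
exists (RCond (stem c) (height c) Y' (family c `&` (Q true `&` Q false))); split.
- split=> //=.
  + by move=> i /Y'S [/Yl].
  + by exists (C + (3 * C + 3 * C)); apply: sparseI => //; exact: sparseI.
  + by split=> // y /Y'S [/FY ? [? ?]].
- by split=> //= [i|i /Y'S []] //; left.
- right; exists x => E b /= [_ [QtE QfE]] /growsP [FE EY].
  have FE' : grows (pool c) (stem c) E.
    by apply/growsP; split=> // i /EY [|/Y'S []]; [left|right].
  by case: b; [exact: nt | exact: nf].
Qed.

(** * The initial reservoir and the generic rainbow *)

Fixpoint answer_yes (c : code) : code :=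
  match c with
  | Query => Comp Succ Zero
  | Pair c d => Pair (answer_yes c) (answer_yes d)
  | Comp c d => Comp (answer_yes c) (answer_yes d)
  | Prec c d => Prec (answer_yes c) (answer_yes d)
  | Mu c => Mu (answer_yes c)
  | c => c
  end.

Lemma eval_answer_yes X c x y : eval setT c x y -> eval X (answer_yes c) x y.
Proof.
elim: c x y => [||||| c IHc d IHd | c IHc d IHd | c IHc d IHd | c IHc] x y //=.
- by rewrite in_setT => ->; exists 0.
- by move=> [u [v [/IHc ? /IHd ? ->]]]; exists u, v.
- by move=> [u /IHd ? /IHc ?]; exists u.
- elim: (Cantor.of_nat x).2 y => [|n IHn] y; first exact: IHc.
  by move=> [u /IHn ? /IHd ?]; exists u.
- move=> [/IHc ? H]; split=> // i /H [u /IHc ?].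
  by exists u.
Qed.

(** Replacing queries by the constant 1 turns a program with oracle [setT] into a partial recursive
    function. At its own number it takes the value that [h] would have to avoid. *)
Lemma nonPA_setT : ~ PA_degree setT.
Proof.
move=> [h [c ch] hP]; apply: (hP (encode (answer_yes c))) (erefl _).
by exists (answer_yes c) => //; apply: eval_answer_yes.
Qed.

Theorem theorem4p4 (f : upair -> nat) (hf : two_bounded f) :
  exists X : set nat, [/\ infinite_set X, rainbow f X & ~ PA_degree X].
Proof.
have [e eP] := code_enum.
have good0 : rgood (RCond 0 0 setT (rainbows f)).
  split=> //=; first by move=> i; rewrite bit_0.
  - split; first exact: infinite_nat.
    exact: nonPA_setT.
  - by exists 8; exact: sparse_rainbows.
  - have R w : (forall i j, bit w i -> bit w j -> i = j) -> rainbows f w.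
      move=> w1 p q; rewrite !inE => pw _ _; have [x [y [/eqP xy pxy]]] := upair_eq p.
      by case: xy; apply: w1; apply: pw; rewrite pxy !inE eqxx ?orbT.
    split; first by apply: R => i j; rewrite bit_0.
    by move=> y _; apply: R => i j; rewrite !bit_adjoin !bit_0 => /eqP -> /eqP ->.
pose T := {c | rgood c}.
pose Den n (x : T) := [/\ n <= height (sval x),
  exists2 i, n <= i & bit (stem (sval x)) i & rsat (sval x) (e n)].
have [|s [s0 sext sDen]] := @generic_sequence T
    (fun x y => rext (sval x) (sval y)) Den (exist _ _ good0).
  move=> n [c gc]; have [c1 [gc1 cc1 nc1 [i ni ci]]] := rgrowth n gc.
  have [c2 [gc2 cc2 sc2]] := rdecide (e n) gc1.
  exists (exist _ c2 gc2) => /=; first exact: rext_trans cc2.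
  have [l12 s12 _ _ _] := cc2; split=> //=; first exact: leq_trans l12.
  by exists i => //; rewrite s12 //; have [sl _ _ _ _] := gc1; exact: sl.
pose c n := sval (s n); have gc n : rgood (c n) by exact: svalP (s n).
have cext n m : n <= m -> rext (c n) (c m).
  elim: m => [|m IHm]; first by rewrite leqn0 => /eqP ->; exact: rext_refl.
  rewrite leq_eqVlt => /orP[/eqP ->|/IHm nm]; first exact: rext_refl.
  exact: rext_trans nm (sext m).
pose G := [set i | exists n, bit (stem (c n)) i].
have GE n i : i < height (c n) -> (i \in G) = bit (stem (c n)) i.
  move=> il; apply/idP/idP => [/set_mem [m mi]|ni]; last by apply/mem_set; exists n.
  have [sl _ _ _ _] := gc m; have im := sl i mi.
  case: (leqP n m) => [/cext|/ltnW /cext] [_ E _ _ _]; first by rewrite -E.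
  by rewrite E.
have heightP n : n <= height (c n.+1) by have [] := sDen n.
have grow n m : n <= m -> grows (pool (c n)) (stem (c n)) (stem (c m)).
  move=> /cext [_ E S _ _]; apply/growsP; split=> // i ni.
  by rewrite E //; have [sl _ _ _ _] := gc n; exact: sl.
have fam n m : n <= m -> family (c n) (stem (c m)).
  by move=> /cext [_ _ _ _]; apply; have [_ _ _ _ []] := gc m.
exists G; split.
- apply: unbounded_infinite => n; have [_ [i ni ci] _] := sDen n.
  by exists i => //; exists n.+1.
- move=> p q; rewrite !inE => pG qG fpq.
  (* Below [N] the set [G] agrees with the stem of stage [N.+1], which is a rainbow as it belongs to
     the initial family. *)
  have [N NP] : exists N, forall x, (x \in val p) || (x \in val q) -> x < N.
    have [x [y [_ pxy]]] := upair_eq p; have [x' [y' [_ qxy]]] := upair_eq q.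
    exists (x + y + x' + y').+1 => z; rewrite pxy qxy !inE.
    by move=> /orP[] /orP[] /eqP ->; lia.
  have := fam 0 N.+1 (leq0n _); rewrite /c s0 /= => R; apply: R => //; rewrite inE => x xp /=;
    rewrite -/(c N.+1) -GE.
  + exact/mem_set/pG.
  + by apply: leq_trans (heightP N); apply: NP; rewrite xp.
  + exact/mem_set/qG.
  + by apply: leq_trans (heightP N); apply: NP; rewrite xp orbT.
- apply: nonPA_of => d; have [n en] := eP d; have [_ _] := sDen n; rewrite en.
  case=> [[x [b [xb ev]]]|[x noE]]; [left|right].
    by exists x, b; split=> //; apply: ev => i; exact: GE.
  exists x => b /eval_forces [l0 fl0].
  (* The stem of stage [m] extends the condition satisfying [noE] and is decided up to the use [l0]
     of the computation. *)
  pose m := (n + l0).+1; have nm : n.+1 <= m by rewrite /m; lia.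
  apply: (noE (stem (c m)) b); [exact: fam | exact: grow | apply: fl0 => i il].
  by apply: GE; apply: leq_trans (heightP _); move: il; lia.
Qed.
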